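(* The mirror of every complex reflection in $\Gamma_1$ is in the $\Gamma_1$-orbit of the mirror polar to exactly one of the vectors $w_1=(0,1,0)$, $w_2=(1,-1,0)$, $w_3=(1,0,1)$. The subgroup of $\Gamma_1$ fixing pointwise the mirror polar to $w_1$, $w_2$, $w_3$ is cyclic of order $4$, $4$, $2$ respectively.
   Context: On $\mathbb{C}^3$ let $\langle v,w\rangle=w^*Jv$ with $J=\begin{pmatrix}0&0&1\\0&1&0\\1&0&0\end{pmatrix}$, $U(J)=\{A\in GL_3(\mathbb{C}):A^*JA=J\}$, and let $\Gamma_d=PU(J,\mathcal{O}_d)$ be the image in $PU(J)$ of $U(J)\cap GL_3(\mathcal{O}_d)$, with $\mathcal{O}_d$ the ring of integers of $\mathbb{Q}(i\sqrt d)$ (so $\mathcal{O}_1=\mathbb{Z}[i]$). It acts on the complex hyperbolic plane $\mathbf{H}^2_{\mathbb{C}}=\{\mathbb{C}v:\langle v,v\rangle<0\}$. For $w$ with $\langle w,w\rangle>0$, the mirror polar to $w$ is $\{\mathbb{C}v\in\mathbf{H}^2_{\mathbb{C}}:\langle v,w\rangle=0\}$; a complex reflection is a nontrivial finite-order element fixing pointwise such a mirror. *)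

(* Defs.v *)
From HB Require Import structures.
From mathcomp Require Import all_boot all_order all_algebra.
From mathcomp Require Import sesquilinear spectral generic_quotient complex.
From mathcomp Require Import boolp classical_sets functions cardinality reals.
Set Implicit Arguments.
Unset Strict Implicit.
Unset Printing Implicit Defensive.

Import Order.TTheory GRing.Theory Num.Theory.
Local Open Scope ring_scope.
Local Open Scope classical_set_scope.
Local Open Scope quotient_scope.
Local Open Scope sesquilinear_scope.

Section HermitianForm.
Variable C : numClosedFieldType.

Definition Jmx : 'M[C]_3 := \matrix_(i, j) (i + j == 2)%N%:R.

(* Linear in the first argument, conjugate-linear in the second. *)
Definition herm (v w : 'cV[C]_3) : C := (w ^t* *m Jmx *m v) 0 0.

(* A ^t* is the conjugate transpose of A. *)
Definition in_UJ (A : 'M[C]_3) : bool :=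
  (A \in unitmx) && (A ^t* *m Jmx *m A == Jmx).

Record UJ := MkUJ { UJ_val :> 'M[C]_3; UJ_valP : in_UJ UJ_val }.

HB.instance Definition _ := [isSub for UJ_val].
HB.instance Definition _ := [Choice of UJ by <:].

Lemma UJ_unit (A : UJ) : (A : 'M[C]_3) \in unitmx.
Proof. by have /andP[] := UJ_valP A. Qed.

Lemma UJ_form (A : UJ) : (A : 'M[C]_3) ^t* *m Jmx *m A = Jmx.
Proof. by have /andP[_ /eqP] := UJ_valP A. Qed.

Lemma in_UJ1 : in_UJ 1%:M.
Proof.
by rewrite /in_UJ unitmx1 trmx1 map_mx1 mul1mx mulmx1 eqxx.
Qed.

Lemma in_UJM (A B : UJ) : in_UJ ((A : 'M[C]_3) *m B).
Proof.
rewrite /in_UJ unitmx_mul !UJ_unit /= trmx_mul map_mxM !mulmxA.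
rewrite -[_ *m (_ ^t*) *m Jmx *m _]mulmxA -[_ *m (_ ^t*) *m _]mulmxA.
by rewrite [_ ^t* *m (Jmx *m _)]mulmxA UJ_form UJ_form.
Qed.

Lemma in_UJV (A : UJ) : in_UJ (invmx A).
Proof.
rewrite /in_UJ unitmx_inv UJ_unit /= -{1}(UJ_form A) !mulmxA.
rewrite -map_mxM -trmx_mul mulmxV ?UJ_unit// trmx1 map_mx1 mul1mx.
by rewrite -mulmxA mulmxV ?UJ_unit// mulmx1.
Qed.

Definition UJ_one := MkUJ in_UJ1.
Definition UJ_mul (A B : UJ) := MkUJ (in_UJM A B).
Definition UJ_inv (A : UJ) := MkUJ (in_UJV A).

Lemma UJ_mulA : associative UJ_mul.
Proof. by move=> A B D; apply: val_inj; rewrite /= mulmxA. Qed.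
Lemma UJ_mul1 : left_id UJ_one UJ_mul.
Proof. by move=> A; apply: val_inj; rewrite /= mul1mx. Qed.
Lemma UJ_mulr1 : right_id UJ_one UJ_mul.
Proof. by move=> A; apply: val_inj; rewrite /= mulmx1. Qed.
Lemma UJ_mulV : left_inverse UJ_one UJ_inv UJ_mul.
Proof. by move=> A; apply: val_inj; rewrite /= mulVmx ?UJ_unit. Qed.
Lemma UJ_mulrV : right_inverse UJ_one UJ_inv UJ_mul.
Proof. by move=> A; apply: val_inj; rewrite /= mulmxV ?UJ_unit. Qed.

HB.instance Definition _ := isGroup.Build UJ
  UJ_mulA UJ_mul1 UJ_mulr1 UJ_mulV UJ_mulrV.

(* PU(J) is the quotient of U(J) by its subgroup of scalar matrices. *)
Definition scalar_eq (A B : UJ) : bool := is_scalar_mx (A^-1 * B : UJ)%g.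

Lemma scalar_eqP (A B : UJ) :
  reflect (exists c : C, (B : 'M[C]_3) = c *: (A : 'M[C]_3)) (scalar_eq A B).
Proof.
apply: (iffP is_scalar_mxP) => -[c E]; exists c.
  rewrite -mul_mx_scalar -E /= mulmxA mulmxV ?UJ_unit// mul1mx //.
by rewrite /= E -scalemxAr mulVmx ?UJ_unit// scalemx1.
Qed.

Lemma scalar_eq_refl : reflexive scalar_eq.
Proof. by move=> A; apply/scalar_eqP; exists 1; rewrite scale1r. Qed.

Lemma UJ_scale_neq0 (A B : UJ) (c : C) :
  (B : 'M[C]_3) = c *: (A : 'M[C]_3) -> c != 0.
Proof.
move=> E; apply/eqP => c0; have := UJ_unit B.
by rewrite E c0 scale0r unitmxE det0 unitr0.
Qed.

Lemma scalar_eq_sym : symmetric scalar_eq.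
Proof.
have H A B : scalar_eq A B -> scalar_eq B A.
  move=> /scalar_eqP[c E]; apply/scalar_eqP; exists c^-1.
  by rewrite E scalerA mulVf ?scale1r// (UJ_scale_neq0 E).
by move=> A B; apply/idP/idP; apply: H.
Qed.

Lemma scalar_eq_trans : transitive scalar_eq.
Proof.
move=> B A D /scalar_eqP[c E] /scalar_eqP[d F]; apply/scalar_eqP.
by exists (d * c); rewrite F E scalerA.
Qed.

Canonical scalar_eq_equiv :=
  EquivRel scalar_eq scalar_eq_refl scalar_eq_sym scalar_eq_trans.

Definition PUJ := {eq_quot scalar_eq}.
HB.instance Definition _ := Choice.on PUJ.
HB.instance Definition _ := EqQuotient.on PUJ.

Definition projU (A : UJ) : PUJ := \pi A.

Lemma projUK (g : PUJ) : projU (repr g) = g.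
Proof. exact: reprK. Qed.

Definition PUJ_one : PUJ := projU 1%g.
Definition PUJ_mul (g h : PUJ) : PUJ := projU (repr g * repr h)%g.
Definition PUJ_inv (g : PUJ) : PUJ := projU (repr g)^-1%g.

Lemma repr_piP (A : UJ) :
  exists2 c : C, c != 0 & (repr (projU A) : 'M[C]_3) = c *: (A : 'M[C]_3).
Proof.
have /scalar_eqP[c E] : scalar_eq A (repr (projU A)).
  by apply/(eqmodP scalar_eq_equiv); rewrite -[LHS]/(projU A) -{1}[projU A]projUK.
by exists c => //; apply: UJ_scale_neq0 E.
Qed.

Lemma pi_eqP (A B : UJ) (c : C) :
  (B : 'M[C]_3) = c *: (A : 'M[C]_3) -> projU A = projU B.
Proof. by move=> E; apply/(eqmodP scalar_eq_equiv)/scalar_eqP; exists c. Qed.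

Lemma PUJ_mulE (A B : UJ) : PUJ_mul (projU A) (projU B) = projU (A * B)%g.
Proof.
have [c _ Ec] := repr_piP A; have [d _ Ed] := repr_piP B.
apply/esym/(@pi_eqP _ _ (c * d)) => /=.
by rewrite Ec Ed -scalemxAl -scalemxAr scalerA.
Qed.

Lemma PUJ_invE (A : UJ) : PUJ_inv (projU A) = projU (A^-1)%g.
Proof.
have [c c0 Ec] := repr_piP A.
apply/esym/(@pi_eqP _ _ c^-1) => /=.
by rewrite Ec invmxZ// -Ec UJ_unit.
Qed.

Lemma PUJ_mulA : associative PUJ_mul.
Proof.
move=> g h k; rewrite -[g]projUK -[h]projUK -[k]projUK.
by rewrite !PUJ_mulE mulgA.
Qed.
Lemma PUJ_mul1 : left_id PUJ_one PUJ_mul.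
Proof. by move=> g; rewrite -[g]projUK PUJ_mulE mul1g. Qed.
Lemma PUJ_mulr1 : right_id PUJ_one PUJ_mul.
Proof. by move=> g; rewrite -[g]projUK PUJ_mulE mulg1. Qed.
Lemma PUJ_mulV : left_inverse PUJ_one PUJ_inv PUJ_mul.
Proof. by move=> g; rewrite -[g]projUK PUJ_invE PUJ_mulE mulVg. Qed.
Lemma PUJ_mulrV : right_inverse PUJ_one PUJ_inv PUJ_mul.
Proof. by move=> g; rewrite -[g]projUK PUJ_invE PUJ_mulE mulgV. Qed.

HB.instance Definition _ := isGroup.Build PUJ
  PUJ_mulA PUJ_mul1 PUJ_mulr1 PUJ_mulV PUJ_mulrV.

Definition gaussian_integers : set C :=
  [set z | exists a b : int, z = a%:~R + 'i * b%:~R].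

Definition GL3_gaussian : set 'M[C]_3 :=
  [set A | [/\ A \in unitmx, forall i j, gaussian_integers (A i j)
           & forall i j, gaussian_integers (invmx A i j)]].

Definition Gamma1 : set PUJ :=
  [set projU A | A in [set A : UJ | GL3_gaussian A]].

(* Points of the complex hyperbolic plane are lines of C^3, i.e. subspaces. *)
Definition H2C : set {vspace 'cV[C]_3} :=
  [set <[v]>%VS | v in [set v | herm v v < 0]].

Definition mirror (w : 'cV[C]_3) : set {vspace 'cV[C]_3} :=
  [set <[v]>%VS | v in [set v | herm v v < 0 /\ herm v w = 0]].

Definition is_mirror (M : set {vspace 'cV[C]_3}) : Prop :=
  exists2 w, 0 < herm w w & M = mirror w.

(* Independent of the representative of g, see act_pi_line. *)
Definition act (g : PUJ) (L : {vspace 'cV[C]_3}) : {vspace 'cV[C]_3} :=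
  (linfun (mulmx (repr g : 'M[C]_3)) @: L)%VS.

Lemma act_pi_line (A : UJ) (v : 'cV[C]_3) :
  act (projU A) <[v]>%VS = <[(A : 'M[C]_3) *m v]>%VS.
Proof.
have [c c0 Ec] := repr_piP A.
rewrite /act limg_line lfunE /= Ec -scalemxAl.
apply/eqP; rewrite eqEsubv -!memvE memvZ ?memv_line//=.
by apply/vlineP; exists c^-1; rewrite scalerA mulVf ?scale1r.
Qed.

Lemma herm_UJ (A : UJ) (v w : 'cV[C]_3) :
  herm ((A : 'M[C]_3) *m v) ((A : 'M[C]_3) *m w) = herm v w.
Proof.
rewrite /herm trmx_mul map_mxM !mulmxA.
rewrite -[_ *m (_ ^t*) *m Jmx *m _]mulmxA -[_ *m (_ ^t*) *m _]mulmxA.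
by rewrite [_ ^t* *m (Jmx *m _)]mulmxA UJ_form.
Qed.

Lemma act_H2C (g : PUJ) (L : {vspace 'cV[C]_3}) : H2C L -> H2C (act g L).
Proof.
move=> [v /= v0 <-]; rewrite -[g]projUK act_pi_line.
by exists ((repr g : 'M[C]_3) *m v) => //=; rewrite herm_UJ.
Qed.

Lemma act1_line (v : 'cV[C]_3) : act 1%g <[v]>%VS = <[v]>%VS.
Proof. by rewrite act_pi_line mul1mx. Qed.

Lemma actM_line (g h : PUJ) (v : 'cV[C]_3) :
  act (g * h)%g <[v]>%VS = act g (act h <[v]>%VS).
Proof.
rewrite -[g]projUK -[h]projUK [X in act X]PUJ_mulE !act_pi_line.
by rewrite mulmxA.
Qed.

Definition fixes_pointwise (g : PUJ) (M : set {vspace 'cV[C]_3}) : Prop :=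
  forall L, M L -> act g L = L.

(* g is a complex reflection and M is a mirror it fixes pointwise. *)
Definition complex_reflection (g : PUJ) (M : set {vspace 'cV[C]_3}) : Prop :=
  [/\ g <> 1%g, exists2 n, (0 < n)%N & (g ^+ n = 1)%g,
      is_mirror M & fixes_pointwise g M].

Definition Gamma1_fixer (M : set {vspace 'cV[C]_3}) : set PUJ :=
  [set g | Gamma1 g /\ fixes_pointwise g M].

Definition Gamma1_orbit (M : set {vspace 'cV[C]_3}) :
    set (set {vspace 'cV[C]_3}) :=
  [set act g @` M | g in Gamma1].

Definition col3 (x y z : C) : 'cV[C]_3 := \col_i [:: x; y; z]`_i.

Definition mirror_vector (k : 'I_3) : 'cV[C]_3 :=
  [:: col3 0 1 0; col3 1 (-1) 0; col3 1 0 1]`_k.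

End HermitianForm.

(* H is the subgroup generated by a single element, and has n elements. *)
Definition cyclic_of_order (G : groupType) (H : set G) (n : nat) : Prop :=
  (exists g : G, H = [set (g ^+ k)%g | k in [set: nat]] `|`
                     [set (g ^- k)%g | k in [set: nat]]) /\
  (H #= `I_n)%card.

(* Main.v *)
Require Import Defs.
From mathcomp Require Import all_boot all_order all_algebra.
From mathcomp Require Import sesquilinear generic_quotient complex.
From mathcomp Require Import boolp classical_sets functions cardinality reals.
From mathcomp Require Import zify ring lra.
Set Implicit Arguments.
Unset Strict Implicit.
Unset Printing Implicit Defensive.
Import Order.TTheory GRing.Theory Num.Theory.
Local Open Scope ring_scope.
Local Open Scope classical_set_scope.
Local Open Scope sesquilinear_scope.

(** A lift A of an element fixing a mirror pointwise acts by a scalar l on the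
    plane polar to w and by a scalar m on w. The integrality of tr A and tr A^2
    forces l to be a unit of Z[i] and m / l to be a fourth root of unity, so
    twice the orthogonal projection onto w is integral. For w primitive this
    gives <w,w> = 1 or 2. Such vectors are brought to w_1, w_2 or w_3 by a
    Euclidean descent on the last coordinate, alternating Heisenberg
    translations with J. The norm separates w_3 from w_1 and w_2, and a parity
    argument on isotropic vectors separates w_1 from w_2. *)

(** The vector w polar to a mirror is an arbitrary complex vector, so arithmetic enters only through
    the lift A = l + (m - l) P, with P the orthogonal projection onto w. A fourth root of unity z
    other than 1 has z - 1 dividing 2 in Z[i]; this makes 2 P integral, and a nonzero column of 2 P
    supplies a Gaussian vector on the line of w. The same divisibility decides the orders: if <w,w>
    = 1 then P itself is integral and all four multipliers occur, while (i - 1) P is not integral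
    for w_3, which leaves the multipliers 1 and -1. The prime 1 + i shapes the reduction. A
    Heisenberg translation by t has -|t|^2 / 2 as the real part of its corner entry, so over Z[i]
    only multiples of 1 + i are available, and coordinates can be normalised only to the residues 0
    and 1. These two residues are the source of the two models of norm 1. *)

Lemma ord3P (P : 'I_3 -> Prop) : P 0 -> P 1 -> P 2%R -> forall i, P i.
Proof.
move=> P0 P1 P2 [[|[|[|//]]] ?].
- by rewrite (_ : Ordinal _ = 0) //; apply/val_inj.
- by rewrite (_ : Ordinal _ = 1) //; apply/val_inj.
by rewrite (_ : Ordinal _ = 2%R) //; apply/val_inj.
Qed.

Lemma sum3 (V : nmodType) (F : 'I_3 -> V) : \sum_i F i = F 0 + F 1 + F 2%R.
Proof.
rewrite 3!big_ord_recr big_ord0 /= add0r.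
by congr (F _ + F _ + F _); apply/val_inj.
Qed.

(** * Hermitian geometry: the shape of a lift that fixes a mirror pointwise *)

Section HermitianGeometry.
Variable C : numClosedFieldType.
Implicit Types (u v w x : 'cV[C]_3) (A : UJ C).

Lemma hermE v w :
  herm v w = (w 2 0)^* * v 0 0 + (w 1 0)^* * v 1 0 + (w 0 0)^* * v 2 0.
Proof. by rewrite /herm !mxE sum3 !mxE !sum3 !mxE /=; ring. Qed.

Lemma col3E (x y z : C) i : col3 x y z i 0 = [:: x; y; z]`_i.
Proof. by rewrite mxE. Qed.

Lemma col3P v : v = col3 (v 0 0) (v 1 0) (v 2 0).
Proof. by apply/colP; apply: ord3P; rewrite col3E. Qed.

Lemma herm_col3 (x y z : C) w :
  herm (col3 x y z) w = (w 2 0)^* * x + (w 1 0)^* * y + (w 0 0)^* * z.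
Proof. by rewrite hermE !col3E. Qed.

Lemma hermC v w : herm w v = (herm v w)^*.
Proof.
rewrite !hermE; have K := @conjCK C.
by rewrite !rmorphD !rmorphM /= !K; ring.
Qed.

Lemma hermDl u v w : herm (u + v) w = herm u w + herm v w.
Proof. by rewrite !hermE !mxE; ring. Qed.

Lemma hermZl a v w : herm (a *: v) w = a * herm v w.
Proof. by rewrite !hermE !mxE; ring. Qed.

Lemma hermDr u v w : herm u (v + w) = herm u v + herm u w.
Proof. by rewrite hermC hermDl rmorphD /= -!hermC. Qed.

Lemma hermZr a v w : herm v (a *: w) = a^* * herm v w.
Proof. by rewrite hermC hermZl rmorphM /= -hermC. Qed.

Lemma hermNl v w : herm (- v) w = - herm v w.
Proof. by rewrite -scaleN1r hermZl mulN1r. Qed.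

Lemma hermNr v w : herm v (- w) = - herm v w.
Proof. by rewrite -scaleN1r hermZr rmorphN1 mulN1r. Qed.

Lemma herm0l w : herm 0 w = 0.
Proof. by rewrite -(scale0r w) hermZl mul0r. Qed.

Lemma herm_nondeg x : (forall v, herm v x = 0) -> x = 0.
Proof.
move=> H; rewrite (col3P x).
have H0 := H (col3 1 0 0); have H1 := H (col3 0 1 0); have H2 := H (col3 0 0 1).
move: H0 H1 H2; rewrite !herm_col3 !mulr0 !mulr1 !add0r !addr0.
move=> /eqP; rewrite conjC_eq0 => /eqP -> /eqP; rewrite conjC_eq0 => /eqP ->.
by move=> /eqP; rewrite conjC_eq0 => /eqP ->; apply/colP; apply: ord3P; rewrite !mxE.
Qed.

Lemma mx_colP (A B : 'M[C]_3) : (forall v, A *m v = B *m v) -> A = B.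
Proof.
move=> H; apply/matrixP => i j.
have /colP/(_ i) := H (delta_mx j 0).
by rewrite -!colE !mxE.
Qed.

(** The rank-one projection onto the line of w; the complementary projection, onto the polar plane,
    is [toward_mirror]. *)
Definition polar_proj w : 'M[C]_3 := (herm w w)^-1 *: (w *m (w ^t* *m Jmx C)).

Lemma polar_projE w v : polar_proj w *m v = (herm v w / herm w w) *: w.
Proof.
rewrite /polar_proj -scalemxAl -mulmxA [_ *m v]mx11_scalar -/(herm v w).
by rewrite mul_mx_scalar scalerA mulrC.
Qed.

Lemma polar_projZ c w : c != 0 -> polar_proj (c *: w) = polar_proj w.
Proof.
move=> c0; apply: mx_colP => v; rewrite !polar_projE !(hermZl, hermZr) scalerA.
have [->|n0] := eqVneq (herm w w) 0; first by rewrite !mulr0 !invr0 !mulr0 mul0r.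
have d0 : c^* != 0 by rewrite conjC_eq0.
by congr (_ *: _); field; rewrite n0 c0 d0.
Qed.

Definition toward_mirror w v := v - (herm v w / herm w w) *: w.

Section Toward.
Variables (w : 'cV[C]_3) (w_gt0 : 0 < herm w w).
Local Notation q := (toward_mirror w).
Let n0 : herm w w != 0. Proof. by rewrite gt_eqF. Qed.
Let nR : (herm w w)^* = herm w w. Proof. by rewrite -hermC. Qed.

Lemma toward_mirrorD u v : q (u + v) = q u + q v.
Proof. by rewrite /toward_mirror hermDl mulrDl scalerDl opprD addrACA. Qed.

Lemma toward_mirrorZ a v : q (a *: v) = a *: q v.
Proof. by rewrite /toward_mirror hermZl scalerBr scalerA mulrA. Qed.

Lemma herm_toward_mirror v : herm (q v) w = 0.
Proof. by rewrite hermDl hermNl hermZl divfK // subrr. Qed.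

Lemma toward_mirror_adj u v : herm (q u) v = herm u (q v).
Proof.
rewrite hermDl hermDr hermNl hermNr hermZl hermZr rmorphM fmorphV /= -!hermC.
by congr (_ - _); ring.
Qed.

(** Removing the component along the positive vector w subtracts |<v,w>|^2 / <w,w> from the norm. *)
Lemma toward_mirror_lt0 v : herm v v < 0 -> herm (q v) (q v) < 0.
Proof.
move=> v0; rewrite /toward_mirror hermDr hermNr hermZr herm_toward_mirror.
rewrite mulr0 subr0 hermDl hermNl hermZl [herm w v]hermC mulrAC -normCK.
rewrite -mulNr (le_lt_trans _ v0) // gerDl mulNr oppr_le0.
by rewrite divr_ge0 ?exprn_ge0 // ltW.
Qed.

End Toward.

(** Comparing both expressions of A (u + v) gives (l'' - l) u = (l' - l'') v. Either l'' = l, and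
    then l' = l'' as well, or u is a multiple of v and shares its eigenvalue. *)
Lemma common_eigenvalue (A : 'M[C]_3) u v l l' l'' : u != 0 -> v != 0 ->
  A *m u = l *: u -> A *m v = l' *: v -> A *m (u + v) = l'' *: (u + v) -> l = l'.
Proof.
move=> u0 v0 Eu Ev; rewrite mulmxDr Eu Ev scalerDr => E.
have {}E : (l'' - l) *: u = (l' - l'') *: v.
  rewrite !scalerBl; apply/eqP; rewrite subr_eq addrAC eq_sym subr_eq addrC E.
  by rewrite addrC.
have [h|h] := eqVneq (l'' - l) 0.
  move: E; rewrite h scale0r => /esym/eqP; rewrite scaler_eq0 (negPf v0) orbF.
  by move: h => /eqP; rewrite !subr_eq0 => /eqP <- /eqP.
have {E} Eu' : u = ((l'' - l)^-1 * (l' - l'')) *: v.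
  by rewrite -scalerA -E scalerA mulVf // scale1r.
have : A *m u = l' *: u.
  by rewrite {1}Eu' -scalemxAr Ev scalerA mulrC -scalerA -Eu'.
rewrite Eu => /eqP; rewrite -subr_eq0 -scalerBl scaler_eq0 (negPf u0) orbF.
by rewrite subr_eq0 => /eqP.
Qed.

Lemma herm_lt0_neq0 v : herm v v < 0 -> v != 0.
Proof. by move=> h; apply/eqP => v0; rewrite v0 herm0l ltxx in h. Qed.

Lemma fixer_eigen A w v : fixes_pointwise (projU A) (mirror w) ->
  herm v v < 0 -> herm v w = 0 -> exists l, (A : 'M_3) *m v = l *: v.
Proof.
move=> F v0 vw; have /F : mirror w <[v]>%VS by exists v.
rewrite act_pi_line => E; have := memv_line ((A : 'M_3) *m v).
by rewrite E => /vlineP[l ->]; exists l.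
Qed.

Lemma herm_real_col3 (x y z : int) :
  let v := col3 x%:~R y%:~R z%:~R : 'cV[C]_3 in
  herm v v = (2 * x * z + y ^+ 2)%:~R.
Proof. by rewrite /= hermE !col3E /=; ring. Qed.

(** The three vectors have norms -2, -1 and -4, and the sums of the first with each of the others
    have norms -7 and -12, so negative vectors span C^3 in a way that suits [common_eigenvalue]. *)
Lemma negative_span v :
  v = (2 * v 0 0 - v 1 0 + v 2 0) *: col3 1%:~R 0%:~R (-1)%:~R
      + v 1 0 *: col3 1%:~R 1%:~R (-1)%:~R
      + (- v 0 0 - v 2 0) *: col3 1%:~R 0%:~R (-2)%:~R.
Proof.
by rewrite {1}(col3P v); apply/colP; apply: ord3P; rewrite !mxE /=; ring.
Qed.

(* Negative vectors with negative pairwise sums force a common eigenvalue on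
   the polar plane; three of them span C^3. *)
Lemma fixer_on_polar A w : 0 < herm w w ->
    fixes_pointwise (projU A) (mirror w) ->
  exists l, forall v, (A : 'M_3) *m toward_mirror w v = l *: toward_mirror w v.
Proof.
move=> w0 F; set q := toward_mirror w.
have qn (x y z : int) : 2 * x * z + y ^+ 2 < 0 ->
    herm (q (col3 x%:~R y%:~R z%:~R)) (q (col3 x%:~R y%:~R z%:~R)) < 0.
  by move=> h; apply: toward_mirror_lt0 => //; rewrite herm_real_col3 ltrz0.
have E (x y z : int) : 2 * x * z + y ^+ 2 < 0 ->
    exists l, (A : 'M_3) *m q (col3 x%:~R y%:~R z%:~R)
      = l *: q (col3 x%:~R y%:~R z%:~R).
  move=> h; apply: (fixer_eigen F); first exact: qn.
  exact: herm_toward_mirror.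
have S (x y z x' y' z' : int) l l' : 2 * x * z + y ^+ 2 < 0 ->
    2 * x' * z' + y' ^+ 2 < 0 ->
    2 * (x + x') * (z + z') + (y + y') ^+ 2 < 0 ->
    (A : 'M_3) *m q (col3 x%:~R y%:~R z%:~R) = l *: q (col3 x%:~R y%:~R z%:~R) ->
    (A : 'M_3) *m q (col3 x'%:~R y'%:~R z'%:~R)
      = l' *: q (col3 x'%:~R y'%:~R z'%:~R) -> l = l'.
  move=> h h' hs El El'; have [l'' Es] := E _ _ _ hs.
  apply: (common_eigenvalue (herm_lt0_neq0 (qn _ _ _ h))
    (herm_lt0_neq0 (qn _ _ _ h')) El El' (l'' := l'')).
  rewrite -toward_mirrorD (_ : col3 _ _ _ + col3 _ _ _ =
    col3 (x + x')%:~R (y + y')%:~R (z + z')%:~R) //.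
  by apply/colP; apply: ord3P; rewrite !mxE /= rmorphD.
have [l1 E1] := E 1 0 (-1) isT; have [l2 E2] := E 1 1 (-1) isT.
have [l3 E3] := E 1 0 (-2) isT.
have e2 := S 1 0 (-1) 1 1 (-1) _ _ isT isT isT E1 E2.
have e3 := S 1 0 (-1) 1 0 (-2) _ _ isT isT isT E1 E3.
subst l2 l3; exists l1 => v.
rewrite (negative_span v).
rewrite /q in E1 E2 E3 *; rewrite !(toward_mirrorD, toward_mirrorZ) !mulmxDr -!scalemxAr E1 E2 E3 !scalerDr !scalerA.
by rewrite ![_ * l1]mulrC.
Qed.

Lemma fixer_structure A w : 0 < herm w w ->
    fixes_pointwise (projU A) (mirror w) ->
  exists l m, [/\ l * l^* = 1, m * m^* = 1 &
                  (A : 'M_3) = l%:M + (m - l) *: polar_proj w].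
Proof.
move=> w0 F; have [l El] := fixer_on_polar w0 F.
have w1 : herm w w != 0 by rewrite gt_eqF.
have ll : l * l^* = 1.
  have v0 : herm (toward_mirror w (col3 1 0 (-1)))
                 (toward_mirror w (col3 1 0 (-1))) < 0.
    apply: toward_mirror_lt0 => //.
    have := herm_real_col3 1 0 (-1); rewrite /= mulrN1z => ->.
    by rewrite ltrz0.
  have := herm_UJ A (toward_mirror w (col3 1 0 (-1)))
                 (toward_mirror w (col3 1 0 (-1))).
  rewrite El hermZl hermZr mulrA -[RHS]mul1r; apply: mulIf.
  by rewrite lt_eqF.
have l0 : l != 0 by apply/eqP => l0; move: ll; rewrite l0 mul0r => /esym/eqP; rewrite oner_eq0.
set x := (A : 'M_3) *m w.
(* A acts on the polar plane by l and preserves the form, so l <q v, A w> = <q v, w> = 0 for every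
   v: the vector A w stays orthogonal to the polar plane. *)
have Ex : toward_mirror w x = 0.
  apply: herm_nondeg => v; rewrite -toward_mirror_adj //.
  apply: (mulfI l0); rewrite -hermZl -El herm_UJ herm_toward_mirror // mulr0 //.
have {}Ex : x = (herm x w / herm w w) *: w.
  by move: Ex => /eqP; rewrite subr_eq0 => /eqP.
set m := herm x w / herm w w in Ex.
exists l, m; split => //.
  have := herm_UJ A w w; rewrite -/x Ex hermZl hermZr mulrA -[RHS]mul1r.
  exact: mulIf.
apply: mx_colP => v; rewrite mulmxDl mul_scalar_mx -scalemxAl polar_projE.
have {1}-> : v = toward_mirror w v + (herm v w / herm w w) *: w.
  by rewrite subrK.
rewrite mulmxDr El -scalemxAr -/x Ex /toward_mirror scalerBr scalerBl -addrA.
by congr (_ + _); rewrite !scalerA addrC [_ * m]mulrC.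
Qed.

Lemma tr_polar_proj w : herm w w != 0 -> \tr (polar_proj w) = 1.
Proof.
move=> w0; rewrite mxtraceZ mxtrace_mulC trace_mx11 -/(herm w w) mulVf //.
Qed.

Lemma polar_proj_idem w : herm w w != 0 ->
  polar_proj w *m polar_proj w = polar_proj w.
Proof.
move=> w0; apply: mx_colP => v.
by rewrite -mulmxA !polar_projE hermZl divfK.
Qed.
End HermitianGeometry.

(** * Integer inequalities behind Euclidean division in Z[i] and the height descent *)

Section IntegerDescent.
Implicit Types (a d k n : int).

Lemma centered_mod a d : 0 < d ->
  exists k, (- d <= 2 * (a + k * d)) && (2 * (a + k * d) <= d).
Proof.
move=> d0; exists (- ((2 * a + d) %/ (2 * d))%Z).
have := divz_eq (2 * a + d) (2 * d).
have := modz_ge0 (2 * a + d) (d := 2 * d); have := ltz_pmod (2 * a + d) (d := 2 * d).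
by lia.
Qed.

Lemma sqr_le_of_bounds (a d : int) : - d <= a -> a <= d -> a ^+ 2 <= d ^+ 2.
Proof. by nia. Qed.

Lemma bounds_of_sqr_le (a b m : int) : 0 <= m -> a ^+ 2 + b ^+ 2 <= m ^+ 2 ->
  - m <= a <= m.
Proof.
move=> m0 h; rewrite -ler_norml -(ler_pXn2r (n := 2)) ?nnegrE ?normr_ge0 //.
by rewrite real_normK ?num_real // (le_trans _ h) // lerDl sqr_ge0.
Qed.

(** Both coordinates of y * conj(d) / D, with D = |d|^2, are rounded to nearest integers; each error
    is at most 1/2, so |y + q d|^2 <= D / 2. *)
Lemma gaussian_division (y1 y2 d1 d2 : int) : 0 < d1 ^+ 2 + d2 ^+ 2 ->
  exists q1 q2 : int,
    2 * ((y1 + (q1 * d1 - q2 * d2)) ^+ 2 + (y2 + (q1 * d2 + q2 * d1)) ^+ 2)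
      <= d1 ^+ 2 + d2 ^+ 2.
Proof.
set D := d1 ^+ 2 + d2 ^+ 2 => D0.
have [q1 /andP[a1 a2]] := centered_mod (y1 * d1 + y2 * d2) D0.
have [q2 /andP[b1 b2]] := centered_mod (y2 * d1 - y1 * d2) D0.
exists q1, q2; rewrite -(ler_pM2r D0).
have := sqr_le_of_bounds a1 a2; have := sqr_le_of_bounds b1 b2.
set S := (y1 + _) ^+ 2 + _; have -> : 2 * S * D =
  2 * ((y1 * d1 + y2 * d2 + q1 * D) ^+ 2 + (y2 * d1 - y1 * d2 + q2 * D) ^+ 2).
  by rewrite /S /D; ring.
by move: (_ + q1 * D) (_ + q2 * D) => a b; lra.
Qed.

(* First reduce y modulo (1 + i) z, to |y| <= |z|, then the imaginary part of
   x / z; the real part of x / z is then controlled by the norm n. *)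
Lemma height_descent n (x1 x2 y1 y2 z1 z2 : int) :
    (n == 1) || (n == 2) ->
    2 * (x1 * z1 + x2 * z2) + y1 ^+ 2 + y2 ^+ 2 = n ->
    2 <= z1 ^+ 2 + z2 ^+ 2 ->
  exists q1 q2 k : int,
    (x1 - ((q1 - q2) * y1 + (q1 + q2) * y2)
       - (q1 ^+ 2 + q2 ^+ 2) * z1 - k * z2) ^+ 2 +
    (x2 - ((q1 - q2) * y2 - (q1 + q2) * y1)
       - (q1 ^+ 2 + q2 ^+ 2) * z2 + k * z1) ^+ 2 < z1 ^+ 2 + z2 ^+ 2.
Proof.
set D := z1 ^+ 2 + z2 ^+ 2 => nE H D2; have D0 : 0 < D by lia.
(* The divisor (z1 - z2) + i (z1 + z2) is (1 + i) z, the smallest step by which an integral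
   translation can move y. *)
have E : (z1 - z2) ^+ 2 + (z1 + z2) ^+ 2 = 2 * D by rewrite /D; ring.
have [|q1 [q2]] := @gaussian_division y1 y2 (z1 - z2) (z1 + z2).
  by rewrite E mulr_gt0.
rewrite E {E}.
set Y1 := y1 + _; set Y2 := y2 + _ => HY.
set X1 := x1 - ((q1 - q2) * y1 + (q1 + q2) * y2) - (q1 ^+ 2 + q2 ^+ 2) * z1.
set X2 := x2 - ((q1 - q2) * y2 - (q1 + q2) * y1) - (q1 ^+ 2 + q2 ^+ 2) * z2.
have H' : 2 * (X1 * z1 + X2 * z2) + (Y1 ^+ 2 + Y2 ^+ 2) = n.
  by rewrite -H /X1 /X2 /Y1 /Y2; ring.
have [k /andP[k1 k2]] := centered_mod (X2 * z1 - X1 * z2) D0.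
exists q1, q2, k; rewrite -(ltr_pM2r D0).
(* Multiplication by conj(z) splits the new first coordinate into a real part a, unaffected by k,
   and an imaginary part b, already centred modulo D. Since 2 a = n - |Y|^2 with 0 <= |Y|^2 <= D, 1
   <= n <= 2 and D >= 2, also |2 a| <= D; hence a^2 + b^2 <= D^2 / 2 < D^2. *)
have -> : ((X1 - k * z2) ^+ 2 + (X2 + k * z1) ^+ 2) * D =
  (X1 * z1 + X2 * z2) ^+ 2 + (X2 * z1 - X1 * z2 + k * D) ^+ 2.
  by rewrite /D; ring.
have [n1 n2] : 1 <= n /\ n <= 2 by case/orP: nE => /eqP ->.
have := sqr_le_of_bounds k1 k2.
have := @sqr_le_of_bounds (2 * (X1 * z1 + X2 * z2)) D.
have : 0 <= Y1 ^+ 2 + Y2 ^+ 2 by rewrite addr_ge0 ?sqr_ge0.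
move: H' HY {H}; move: (_ + Y2 ^+ 2) (X1 * z1 + _) (_ + k * D) => y a b.
move=> H' HY y0 /(_ ltac:(lra) ltac:(lra)) ha hb.
by have := mulr_gt0 D0 D0; lra.
Qed.

(** The correction is (1 + i) (q1 + i q2), and 0 and 1 represent Z[i] modulo 1 + i. *)
Lemma gaussian_mod (y1 y2 : int) : exists q1 q2 : int,
  (y1 + (q1 - q2) = 0 \/ y1 + (q1 - q2) = 1) /\ y2 + (q1 + q2) = 0.
Proof.
exists (- ((y1 + y2) %/ 2)%Z), (- y2 + ((y1 + y2) %/ 2)%Z).
by lia.
Qed.

End IntegerDescent.

(** * Gaussian integers, integral isometries and their action on vectors *)

Section GaussianVectors.
Variable C : numClosedFieldType.
Implicit Types (u v w x : 'cV[C]_3) (A B : UJ C).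
Local Notation Zi := (@gaussian_integers C).

Definition gauss_pair (a b : int) : C := a%:~R + 'i * b%:~R.
Local Notation gz := gauss_pair.

Lemma gz_gauss a b : Zi (gz a b). Proof. by exists a, b. Qed.

Lemma gzD a b c d : gz a b + gz c d = gz (a + c) (b + d).
Proof. by rewrite /gz; ring. Qed.

Lemma gzN a b : - gz a b = gz (- a) (- b).
Proof. by rewrite /gz; ring. Qed.

Lemma gzM a b c d : gz a b * gz c d = gz (a * c - b * d) (a * d + b * c).
Proof. by rewrite /gz; ring: (sqrCi C). Qed.

Lemma gz_conj a b : (gz a b)^* = gz a (- b).
Proof. by rewrite /gz; ring: (conjCi C). Qed.

Lemma gz_norm a b : gz a b * (gz a b)^* = (a ^+ 2 + b ^+ 2)%:~R.
Proof. by rewrite gz_conj gzM /gz (_ : _ + b * a = 0) ?mulr0 ?addr0; [congr intr|]; ring. Qed.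

Lemma gz_eq0 a b : (gz a b == 0) = (a ^+ 2 + b ^+ 2 == 0).
Proof.
by rewrite -(intr_eq0 C) -gz_norm mulf_eq0 conjC_eq0 orbb.
Qed.

Lemma gz_inj a b c d : gz a b = gz c d -> a = c /\ b = d.
Proof.
move/eqP; rewrite -subr_eq0 gzN gzD gz_eq0 => /eqP.
by split; nia.
Qed.

Lemma gz_int a : a%:~R = gz a 0.
Proof. by rewrite /gz mulr0 addr0. Qed.

Lemma gz_i : 'i = gz 0 1.
Proof. by rewrite /gz add0r mulr1. Qed.

Lemma gauss_int (a : int) : Zi a%:~R.
Proof. by rewrite gz_int; apply: gz_gauss. Qed.

Lemma gauss_nat (n : nat) : Zi n%:R.
Proof. exact: (gauss_int n). Qed.

Lemma gauss0 : Zi 0. Proof. exact: (gauss_int 0). Qed.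
Lemma gauss1 : Zi 1. Proof. exact: (gauss_int 1). Qed.

Lemma gaussi : Zi 'i. Proof. by rewrite gz_i; apply: gz_gauss. Qed.

Lemma gaussD a b : Zi a -> Zi b -> Zi (a + b).
Proof. by move=> [a1 [a2 ->]] [b1 [b2 ->]]; rewrite gzD; apply: gz_gauss. Qed.

Lemma gaussN a : Zi a -> Zi (- a).
Proof. by move=> [a1 [a2 ->]]; rewrite gzN; apply: gz_gauss. Qed.

Lemma gaussM a b : Zi a -> Zi b -> Zi (a * b).
Proof. by move=> [a1 [a2 ->]] [b1 [b2 ->]]; rewrite gzM; apply: gz_gauss. Qed.

Lemma gaussX a n : Zi a -> Zi (a ^+ n).
Proof.
by move=> ha; elim: n => [|n IH]; [exact: gauss1 | rewrite exprS; apply: gaussM].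
Qed.

Lemma gauss_conj a : Zi a -> Zi a^*.
Proof. by move=> [a1 [a2 ->]]; rewrite gz_conj; apply: gz_gauss. Qed.

Lemma gauss_sum (I : Type) (r : seq I) (P : pred I) (F : I -> C) :
  (forall i, P i -> Zi (F i)) -> Zi (\sum_(i <- r | P i) F i).
Proof. by move=> H; apply: big_ind => //; [exact: gauss0 | exact: gaussD]. Qed.

Lemma gauss_mulmx m n p (A : 'M_(m, n)) (B : 'M_(n, p)) :
  (forall i j, Zi (A i j)) -> (forall i j, Zi (B i j)) ->
  forall i j, Zi ((A *m B) i j).
Proof.
by move=> HA HB i j; rewrite mxE; apply: gauss_sum => k _; apply: gaussM.
Qed.

Lemma gauss_Jmx i j : Zi (Jmx C i j).
Proof. by rewrite mxE; exact: gauss_nat. Qed.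

Lemma gauss_trC m n (A : 'M[C]_(m, n)) :
  (forall i j, Zi (A i j)) -> forall i j, Zi (A ^t* i j).
Proof. by move=> HA i j; rewrite !mxE; apply: gauss_conj. Qed.

Lemma Jmx_invol : Jmx C *m Jmx C = 1%:M.
Proof.
by apply/matrixP; apply: ord3P; apply: ord3P;
  rewrite !mxE sum3 !mxE /= ?(mulr0, mul0r, mulr1, mul1r, addr0, add0r).
Qed.

Lemma UJ_invmxE A : invmx A = Jmx C *m ((A : 'M_3) ^t* *m Jmx C).
Proof.
apply: (can_inj (mulKmx (UJ_unit A))); rewrite mulmxV ?UJ_unit //.
by apply/esym/mulmx1C; rewrite -mulmxA UJ_form Jmx_invol.
Qed.

(** For an isometry the inverse is J A^* J, which inherits integrality from A. *)
Lemma gauss_GL3 A : (forall i j, Zi ((A : 'M_3) i j)) -> GL3_gaussian (A : 'M_3).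
Proof.
move=> HA; split => //; first exact: UJ_unit.
rewrite UJ_invmxE; apply: gauss_mulmx; first exact: gauss_Jmx.
by apply: gauss_mulmx; [exact: gauss_trC | exact: gauss_Jmx].
Qed.

Lemma GL3_gauss A : GL3_gaussian (A : 'M_3) -> forall i j, Zi ((A : 'M_3) i j).
Proof. by case. Qed.

Lemma GL3_gaussM A B :
  GL3_gaussian (A : 'M_3) -> GL3_gaussian (B : 'M_3) ->
  GL3_gaussian ((A * B)%g : UJ C).
Proof.
by move=> /GL3_gauss hA /GL3_gauss hB; apply: gauss_GL3; apply: gauss_mulmx.
Qed.

Lemma GL3_gaussV A : GL3_gaussian (A : 'M_3) -> GL3_gaussian ((A^-1)%g : UJ C).
Proof. by case=> _ _ H; apply: gauss_GL3. Qed.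

(** The factor c ranges over all nonzero complex numbers because a mirror depends only on the line
    of its polar vector. *)
Definition reaches_model w := exists (A : UJ C) k c,
  [/\ GL3_gaussian (A : 'M_3), c != 0 & w = c *: ((A : 'M_3) *m mirror_vector C k)].

Lemma reaches_step B w : (forall i j, Zi ((B : 'M_3) i j)) ->
  reaches_model ((B : 'M_3) *m w) -> reaches_model w.
Proof.
move=> hB [A [k [c [hA c0 E]]]]; exists (B^-1 * A)%g, k, c; split => //.
  by apply: GL3_gaussM => //; apply/GL3_gaussV/gauss_GL3.
by rewrite -[LHS](mulKmx (UJ_unit B)) E -scalemxAr mulmxA.
Qed.

Lemma reaches_scale a w : a != 0 -> reaches_model (a *: w) -> reaches_model w.
Proof.
move=> a0 [A [k [c [hA c0 E]]]]; exists A, k, (a^-1 * c); split => //.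
  by rewrite mulf_neq0 ?invr_eq0.
by rewrite -scalerA -E scalerA mulVf // scale1r.
Qed.

Lemma reaches_self k : reaches_model (mirror_vector C k).
Proof.
exists 1%g, k, 1; rewrite oner_eq0 scale1r mul1mx; split => //.
apply: gauss_GL3 => i j; rewrite /= !mxE; exact: gauss_nat.
Qed.

Definition mx3 (a b c d e f g h k : C) : 'M[C]_3 := \matrix_(i, j)
  (nth [::] [:: [:: a; b; c]; [:: d; e; f]; [:: g; h; k]] i)`_j.

Lemma mx3_col3 (a b c d e f g h k x y z : C) :
  mx3 a b c d e f g h k *m col3 x y z =
  col3 (a * x + b * y + c * z) (d * x + e * y + f * z) (g * x + h * y + k * z).
Proof. by apply/colP; apply: ord3P; rewrite !mxE sum3 !mxE. Qed.

Lemma in_UJP (A : 'M[C]_3) : A ^t* *m Jmx C *m A = Jmx C -> in_UJ A.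
Proof.
move=> H; rewrite /in_UJ H eqxx andbT.
apply: (proj2 (mulmx1_unit (_ : Jmx C *m (A ^t* *m Jmx C) *m A = 1%:M))).
by rewrite -mulmxA H Jmx_invol.
Qed.

(** Heisenberg translation by t = (1 + i) (q1 + i q2), with entries -conj(t) and t beside the
    diagonal. The corner must have real part -|t|^2 / 2, which equals -(q1^2 + q2^2) because of the
    factor 1 + i; k is the free vertical part. *)
Definition heis_mx (q1 q2 k : int) : 'M[C]_3 :=
  mx3 1 (- gz (q1 - q2) (- (q1 + q2))) (gz (- (q1 ^+ 2 + q2 ^+ 2)) k)
      0 1 (gz (q1 - q2) (q1 + q2))
      0 0 1.

Lemma heis_UJ q1 q2 k : in_UJ (heis_mx q1 q2 k).
Proof.
apply: in_UJP; apply/matrixP; apply: ord3P; apply: ord3P;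
  rewrite !mxE sum3 !mxE !sum3 !mxE /= ?rmorphN /= ?gz_conj
    ?(rmorph0, rmorph1) ?(mulr0, mul0r, mulr1, mul1r, addr0, add0r, subrr) //=;
  by rewrite /gz; ring: (sqrCi C).
Qed.

Lemma swap_UJ : in_UJ (Jmx C).
Proof.
apply: in_UJP; rewrite -mulmxA Jmx_invol mulmx1.
by apply/matrixP => i j; rewrite !mxE rmorph_nat addnC.
Qed.

Lemma flip_UJ : in_UJ (mx3 1 0 0 0 (-1) 0 0 0 1).
Proof.
apply: in_UJP; apply/matrixP; apply: ord3P; apply: ord3P;
  rewrite !mxE sum3 !mxE !sum3 !mxE /=;
  by rewrite ?(rmorphN, rmorph0, rmorph1) /=; ring.
Qed.

Lemma reaches_swap (x y z : C) : reaches_model (col3 z y x) -> reaches_model (col3 x y z).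
Proof.
move=> H; apply: (@reaches_step (MkUJ swap_UJ)); first exact: gauss_Jmx.
rewrite (_ : _ *m _ = col3 z y x) //=; apply/colP; apply: ord3P;
  by rewrite !mxE sum3 !mxE /=; ring.
Qed.

Lemma reaches_flip (x y z : C) : reaches_model (col3 x (- y) z) -> reaches_model (col3 x y z).
Proof.
move=> H; apply: (@reaches_step (MkUJ flip_UJ)).
  apply: ord3P; apply: ord3P; rewrite /= !mxE /=; do ?[exact: gauss0 | exact: gauss1].
  by apply/gaussN/gauss1.
rewrite (_ : _ *m _ = col3 x (- y) z) //= mx3_col3.
by congr col3; ring.
Qed.

(** The translated coordinates are expanded in the form in which [height_descent] bounds them. *)
Lemma reaches_heis (q1 q2 k x1 x2 y1 y2 z1 z2 : int) :
  reaches_model (col3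
    (gz (x1 - ((q1 - q2) * y1 + (q1 + q2) * y2)
           - (q1 ^+ 2 + q2 ^+ 2) * z1 - k * z2)
        (x2 - ((q1 - q2) * y2 - (q1 + q2) * y1)
           - (q1 ^+ 2 + q2 ^+ 2) * z2 + k * z1))
    (gz (y1 + (q1 * (z1 - z2) - q2 * (z1 + z2)))
        (y2 + (q1 * (z1 + z2) + q2 * (z1 - z2))))
    (gz z1 z2)) ->
  reaches_model (col3 (gz x1 x2) (gz y1 y2) (gz z1 z2)).
Proof.
move=> H; apply: (@reaches_step (MkUJ (heis_UJ q1 q2 k))).
  apply: ord3P; apply: ord3P; rewrite /= !mxE /=;
    by do ?[exact: gauss0 | exact: gauss1 | exact: gz_gauss | apply: gaussN].
move: H; congr reaches_model; rewrite /= mx3_col3.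
by congr col3; rewrite /gz; ring: (sqrCi C).
Qed.

End GaussianVectors.

(** * Reduction of Gaussian vectors of norm 1 or 2 to the three models *)

Section Reduction.
Variable C : numClosedFieldType.
Local Notation gz := (gauss_pair C).
Local Notation reaches_model := (@reaches_model C).

Lemma gz0 : gz 0 0 = 0. Proof. by rewrite /gauss_pair; ring. Qed.
Lemma gz1 : gz 1 0 = 1. Proof. by rewrite /gauss_pair; ring. Qed.

Lemma col3Z (a x y z : C) : a *: col3 x y z = col3 (a * x) (a * y) (a * z).
Proof. by apply/colP; apply: ord3P; rewrite !mxE. Qed.

Lemma reaches_scale_gz (a b x1 x2 y1 y2 z1 z2 : int) : a ^+ 2 + b ^+ 2 != 0 ->
  reaches_model (col3 (gz (a * x1 - b * x2) (a * x2 + b * x1))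
                      (gz (a * y1 - b * y2) (a * y2 + b * y1))
                      (gz (a * z1 - b * z2) (a * z2 + b * z1))) ->
  reaches_model (col3 (gz x1 x2) (gz y1 y2) (gz z1 z2)).
Proof.
move=> h; rewrite -!gzM -col3Z; apply: reaches_scale.
by rewrite gz_eq0.
Qed.

Lemma reaches_x10 (x1 x2 : int) : reaches_model (col3 (gz x1 x2) (gz 1 0) (gz 0 0)).
Proof.
have [p1 [p2 [h1 h2]]] := gaussian_mod x1 x2.
(* Translation adds -conj(t) to x when y = 1 and z = 0; exchanging p1 and p2 makes this equal to (1
   + i) (p1 + i p2). Residue 0 gives w_1, and residue 1 gives w_2 up to the sign of y. *)
apply: (@reaches_heis C p2 p1 0).
rewrite (_ : x2 - _ - _ + _ = 0); last by lia.
rewrite (_ : x1 - _ - _ - _ = x1 + (p1 - p2)); last by lia.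
rewrite (_ : 1 + _ = 1); last by lia.
rewrite (_ : 0 + _ = 0); last by lia.
rewrite gz0 gz1; case: h1 => ->.
  by rewrite gz0; apply: (reaches_self C 0).
by rewrite gz1; apply: reaches_flip; apply: (reaches_self C 1).
Qed.

(** With z = 1, a translation brings y to 0 or 1 and k cancels the imaginary part of x; the norm
    then determines x. For y = 0 this forces n = 2 and the vector w_3; for y = 1 it forces n = 1 and
    x = 0, so exchanging the ends leads to the case z = 0. *)
Lemma reaches_xy1 (n x1 x2 y1 y2 : int) : (n == 1) || (n == 2) ->
  2 * x1 + y1 ^+ 2 + y2 ^+ 2 = n ->
  reaches_model (col3 (gz x1 x2) (gz y1 y2) (gz 1 0)).
Proof.
move=> nE H; have [q1 [q2 [h1 h2]]] := gaussian_mod y1 y2.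
pose k := - (x2 - ((q1 - q2) * y2 - (q1 + q2) * y1)).
apply: (@reaches_heis C q1 q2 k).
rewrite (_ : x2 - _ - _ + _ = 0); last by rewrite /k; ring.
rewrite (_ : y2 + _ = 0); last by lia.
rewrite (_ : y1 + _ = y1 + (q1 - q2)); last by lia.
set X := x1 - _ - _ - _.
have HX : 2 * X + (y1 + (q1 - q2)) ^+ 2 = n.
  have : 2 * X + (y1 + (q1 - q2)) ^+ 2 + (y2 + (q1 + q2)) ^+ 2 = n.
    by rewrite -H /X; ring.
  by rewrite h2 expr0n addr0.
case: h1 HX => -> HX.
  have -> : X = 1 by lia.
  by rewrite gz0 gz1; apply: (reaches_self C 2%R).
have -> : X = 0 by lia.
by apply: reaches_swap; apply: reaches_x10.
Qed.

Lemma reaches_zunit (n x1 x2 y1 y2 z1 z2 : int) : (n == 1) || (n == 2) ->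
  z1 ^+ 2 + z2 ^+ 2 = 1 -> 2 * (x1 * z1 + x2 * z2) + y1 ^+ 2 + y2 ^+ 2 = n ->
  reaches_model (col3 (gz x1 x2) (gz y1 y2) (gz z1 z2)).
Proof.
(* Scaling by conj(z), a unit, turns the last coordinate into 1. *)
move=> nE z0 H; apply: (@reaches_scale_gz z1 (- z2)).
  by rewrite sqrrN z0.
rewrite (_ : z1 * z1 - _ = 1); last by rewrite -z0; ring.
rewrite (_ : z1 * z2 + _ = 0); last by ring.
apply: reaches_xy1 nE _; rewrite -H.
transitivity (2 * (x1 * z1 + x2 * z2) + (y1 ^+ 2 + y2 ^+ 2) * (z1 ^+ 2 + z2 ^+ 2)).
  by ring.
by rewrite z0; ring.
Qed.

Lemma reaches_z0_norm1 (x1 x2 y1 y2 : int) : y1 ^+ 2 + y2 ^+ 2 = 1 ->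
  reaches_model (col3 (gz x1 x2) (gz y1 y2) (gz 0 0)).
Proof.
move=> H; apply: (@reaches_scale_gz y1 (- y2)).
  by rewrite sqrrN H.
rewrite (_ : y1 * y1 - _ = 1); last by rewrite -H; ring.
rewrite (_ : y1 * y2 + _ = 0); last by ring.
rewrite !mulr0 oppr0 addr0; exact: reaches_x10.
Qed.

Lemma reaches_z0_norm2 (x1 x2 y1 y2 : int) : y1 ^+ 2 + y2 ^+ 2 = 2 ->
  reaches_model (col3 (gz x1 x2) (gz y1 y2) (gz 0 0)).
Proof.
(* |y|^2 = 2 makes y divisible by 1 + i, and x is divisible by 1 + i exactly when x1 + x2 is even.
   In that case the vector is not primitive and dividing by 1 + i leaves |y| = 1. *)
move=> H; have [e|o] := boolP (2 %| x1 + x2)%Z.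
  pose s := ((x1 + x2) %/ 2)%Z; pose t := ((y1 + y2) %/ 2)%Z.
  have Es : x2 = 2 * s - x1 by rewrite /s; lia.
  have Et : y2 = 2 * t - y1.
    have : (2 %| y1 ^+ 2 + y2 ^+ 2)%Z by rewrite H.
    by rewrite !expr2 /t; nia.
  have -> : gz x1 x2 = gz 1 1 * gz s (s - x1).
    by rewrite gzM Es; congr gz; ring.
  have -> : gz y1 y2 = gz 1 1 * gz t (t - y1).
    by rewrite gzM Et; congr gz; ring.
  rewrite gz0 -(mulr0 (gz 1 1)) -col3Z.
  apply: (@reaches_scale _ (gz 1 1)^-1); first by rewrite invr_eq0 gz_eq0.
  rewrite scalerA mulVf ?scale1r ?gz_eq0 // -gz0.
  by apply: reaches_z0_norm1; move: H; rewrite Et; lra.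
(* These equations say y = (1 + i) (s + i t), with s + i t a unit. *)
have [s [t [Es Et Est]]] : exists s t, [/\ y1 + y2 = 2 * s, y2 - y1 = 2 * t
    & s ^+ 2 + t ^+ 2 = 1].
  have e : (y1 + y2 = 2 * ((y1 + y2) %/ 2)%Z).
    have : (2 %| y1 ^+ 2 + y2 ^+ 2)%Z by rewrite H.
    by rewrite !expr2; nia.
  exists ((y1 + y2) %/ 2)%Z, (y2 - ((y1 + y2) %/ 2)%Z); split => //; first by lia.
  by move: e H; move: (_ %/ _)%Z => u; nia.
pose p1 := (x1 %/ 2)%Z; pose p2 := (x2 %/ 2)%Z.
(* The parameter is (s + i t) conj(p), for which conj(t') y = 2 p, where t' is the translation
   length. This reduces both parts of x to 0 or 1; as x1 + x2 is odd, x becomes a unit and the swap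
   applies. *)
apply: (@reaches_heis C (s * p1 + t * p2) (t * p1 - s * p2) 0).
rewrite !(mulr0, mul0r, subr0, addr0).
rewrite [X in gz X _](_ : _ = x1 - 2 * ((s ^+ 2 + t ^+ 2) * p1)); last first.
  rewrite (_ : y1 = s - t) 1?(_ : y2 = s + t); [by ring | lia | lia].
rewrite [X in gz _ X](_ : _ = x2 - 2 * ((s ^+ 2 + t ^+ 2) * p2)); last first.
  rewrite (_ : y1 = s - t) 1?(_ : y2 = s + t); [by ring | lia | lia].
rewrite Est !mul1r; apply: reaches_swap; apply: (@reaches_zunit 2) => //.
  rewrite /p1 /p2; move: o.
  have : x1 - 2 * (x1 %/ 2)%Z = 0 \/ x1 - 2 * (x1 %/ 2)%Z = 1 by lia.
  have : x2 - 2 * (x2 %/ 2)%Z = 0 \/ x2 - 2 * (x2 %/ 2)%Z = 1 by lia.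
  by case=> h; case=> h'; rewrite h h' //; lia.
by rewrite !mul0r -addrA H.
Qed.

Lemma reaches_of_norm (n x1 x2 y1 y2 z1 z2 : int) : (n == 1) || (n == 2) ->
  2 * (x1 * z1 + x2 * z2) + y1 ^+ 2 + y2 ^+ 2 = n ->
  reaches_model (col3 (gz x1 x2) (gz y1 y2) (gz z1 z2)).
Proof.
move=> nE; have [m] : exists m : nat, z1 ^+ 2 + z2 ^+ 2 < m%:Z.
  by exists (absz (z1 ^+ 2 + z2 ^+ 2)).+1; lia.
elim: m x1 x2 y1 y2 z1 z2 => [|m IH] x1 x2 y1 y2 z1 z2 zm H.
  by have := sqr_ge0 z1; have := sqr_ge0 z2; lia.
have z1p := sqr_ge0 z1; have z2p := sqr_ge0 z2.
have [D2|D1] := lerP 2 (z1 ^+ 2 + z2 ^+ 2).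
  have [q1 [q2 [k D]]] := height_descent nE H D2.
  apply: (@reaches_heis C q1 q2 k); apply: reaches_swap; apply: IH.
    by move: D zm; move: (_ + _) (_ + _); lia.
  by rewrite -H; ring.
have [D0|D0] := eqVneq (z1 ^+ 2 + z2 ^+ 2) 0; last first.
  by apply: (reaches_zunit nE) => //; lia.
have [Ez1 Ez2] : z1 = 0 /\ z2 = 0.
  by apply: (@gz_inj C); rewrite gz0; apply/eqP; rewrite gz_eq0 D0.
move: H; rewrite Ez1 Ez2 !mulr0 !add0r => H.
case/orP: nE => /eqP nE; [apply: reaches_z0_norm1 | apply: reaches_z0_norm2];
  by rewrite H.
Qed.

End Reduction.

(** * Eigenvalues of an integral lift *)

Section ReflectionArithmetic.
Variable C : numClosedFieldType.
Implicit Types (u v w x : 'cV[C]_3) (A B : UJ C).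
Local Notation Zi := (@gaussian_integers C).
Local Notation gz := (gauss_pair C).

Lemma gauss_of_sqr (l : C) : l ^+ 2 = 1 \/ l ^+ 2 = -1 -> Zi l.
Proof.
case=> /eqP.
  rewrite sqrf_eq1 => /orP[] /eqP ->; first exact: gauss1.
  exact/gaussN/gauss1.
by rewrite -(sqrCi C) eqf_sqr => /orP[] /eqP ->; [|apply: gaussN]; apply: gaussi.
Qed.

(** The equation, which links |t|^2 = M and |t2|^2 = e in [eigenvalue_arith], forces M to be odd; 3
    and 7 are not sums of two squares. *)
Lemma odd_sqr_sum (a b e : int) : let M := a ^+ 2 + b ^+ 2 in
  1 <= M -> M <= 9 -> 2 * e = 2 + (M - 5) ^+ 2 -> M = 1 \/ M = 5 \/ M = 9.
Proof.
move=> M M1 M9; rewrite -/M.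
have : M <> 3 /\ M <> 7.
  have : -3 <= a <= 3 by apply: (@bounds_of_sqr_le a b).
  have : -3 <= b <= 3 by apply: (@bounds_of_sqr_le b a); rewrite // addrC.
  rewrite /M => hb ha.
  have hA : a ^+ 2 = 0 \/ a ^+ 2 = 1 \/ a ^+ 2 = 4 \/ a ^+ 2 = 9.
    have : a = -3 \/ a = -2 \/ a = -1 \/ a = 0 \/ a = 1 \/ a = 2 \/ a = 3 by lia.
    by do !case=> [->|]; try move=> ->; lia.
  have hB : b ^+ 2 = 0 \/ b ^+ 2 = 1 \/ b ^+ 2 = 4 \/ b ^+ 2 = 9.
    have : b = -3 \/ b = -2 \/ b = -1 \/ b = 0 \/ b = 1 \/ b = 2 \/ b = 3 by lia.
    by do !case=> [->|]; try move=> ->; lia.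
  by lia.
move: M1 M9; move: M => M M1 M9.
have : M = 1 \/ M = 2 \/ M = 3 \/ M = 4 \/ M = 5 \/ M = 6 \/ M = 7 \/ M = 8 \/ M = 9.
  by lia.
by do !case=> [->|]; try move=> ->; rewrite ?expr2; lia.
Qed.

(* The traces t = 2 l + m of A and t2 = 2 l^2 + m^2 of A^2 satisfy
   |t|^2 = 5 + 2 s and |t2|^2 = 1 + 2 s^2 with s = 2 Re (l / m), so |t|^2 is an
   odd sum of two squares between 1 and 9. *)
Lemma eigenvalue_arith (l m : C) : l * l^* = 1 -> m * m^* = 1 ->
    Zi (2 * l + m) -> Zi (2 * l ^+ 2 + m ^+ 2) -> l != m ->
  Zi l /\ (m = - l \/ m = 'i * l \/ m = - 'i * l).
Proof.
move=> hl hm [a [b Et]] [c [d Et2]] lm.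
rewrite -!/(gz _ _) in Et Et2.
pose s := l * m^* + m * l^*.
have EM : (a ^+ 2 + b ^+ 2)%:~R = 5 + 2 * s :> C.
  by rewrite -gz_norm -Et rmorphD rmorphM /= rmorph_nat /s; ring: hl hm.
have EM2 : (c ^+ 2 + d ^+ 2)%:~R = 1 + 2 * s ^+ 2 :> C.
  rewrite -gz_norm -Et2 rmorphD rmorphM /= !rmorphXn /= rmorph_nat /s.
  by ring: hl hm.
have Hlow : (l - m) * (l - m)^* = 2 - s.
  by rewrite rmorphB /= /s; ring: hl hm.
have Hup : (l + m) * (l + m)^* = 2 + s.
  by rewrite rmorphD /= /s; ring: hl hm.
have sE : s = 2^-1 * ((a ^+ 2 + b ^+ 2)%:~R - 5).
  by rewrite EM; field.
have h9 : a ^+ 2 + b ^+ 2 <= 9.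
  have : 0 <= 2 * (2 - s) by rewrite -Hlow mulr_ge0 ?mul_conjC_ge0.
  rewrite (_ : 2 * _ = (9 - (a ^+ 2 + b ^+ 2))%:~R); last by rewrite sE; field.
  by rewrite ler0z; lia.
have h1 : 1 <= a ^+ 2 + b ^+ 2.
  have : 0 <= 2 * (2 + s) by rewrite -Hup mulr_ge0 ?mul_conjC_ge0.
  rewrite (_ : 2 * _ = ((a ^+ 2 + b ^+ 2) - 1)%:~R); last by rewrite sE; field.
  by rewrite ler0z; lia.
have h2 : 2 * (c ^+ 2 + d ^+ 2) = 2 + ((a ^+ 2 + b ^+ 2) - 5) ^+ 2.
  by apply: (@intr_inj C); rewrite rmorphM /= EM2 sE; field.
(* The values 1, 5, 9 correspond to s = -2, 0, 2, that is to m = -l, to m = i l or -i l, and to the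
   excluded case m = l. *)
have [M1|[M5|M9]] := odd_sqr_sum h1 h9 h2.
- have h : m = - l.
    by apply/eqP; rewrite -addr_eq0 addrC -mul_conjC_eq0 Hup sE M1; apply/eqP; field.
  split; last by left.
  move: Et; rewrite h => El; exists a, b; rewrite -/(gz a b) -El; ring.
- have s0 : s = 0 by rewrite sE M5 subrr mulr0.
  have ml : m ^+ 2 = - l ^+ 2.
    apply/eqP; rewrite -addr_eq0; apply/eqP.
    transitivity (l * m * s); last by rewrite s0 mulr0.
    by rewrite /s; ring: hl hm.
  have El2 : l ^+ 2 = gz c d by rewrite -Et2 ml; ring.
  have cd : c ^+ 2 + d ^+ 2 = 1 by move: h2; rewrite M5; lia.
  have [e he Em] : exists2 e : int, e = 1 \/ e = -1 & m = 'i * e%:~R * l.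
    have /eqP : m ^+ 2 = ('i * l) ^+ 2 by rewrite ml exprMn sqrCi mulN1r.
    rewrite eqf_sqr => /orP[] /eqP ->; [exists 1|exists (-1)]; by [left|right|ring].
  (* Only l^2 = c + i d is known to be Gaussian so far. Squaring t = (2 + e i) l gives t^2 = (3 + 4
     e i) l^2, whose imaginary part makes d even; as |l^2| = 1, d = 0 and l^2 is 1 or -1. *)
  have : gz (a ^+ 2 - b ^+ 2) (2 * a * b) = gz (3 * c - 4 * e * d) (3 * d + 4 * e * c).
    transitivity (gz a b ^+ 2); first by rewrite [RHS]expr2 gzM; congr gauss_pair; ring.
    transitivity (gz 3 (4 * e) * gz c d); last by rewrite gzM; congr gauss_pair; ring.
    rewrite -Et -El2 Em /gauss_pair.
    by case: he => ->; ring: (sqrCi C).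
  move=> /gz_inj[_ hd].
  have d0 : d = 0.
    have : -1 <= d <= 1 by apply: (@bounds_of_sqr_le d c); rewrite // addrC cd.
    by case: he hd => ->; lia.
  split; last by case: he Em => -> ->; right; [left|right]; ring.
  apply: gauss_of_sqr; rewrite El2 d0.
  move: cd; rewrite d0 expr0n addr0 => /eqP; rewrite sqrf_eq1.
  by case/orP => /eqP ->; [left|right]; rewrite /gauss_pair; ring.
- have := Hlow; rewrite sE M9 => /eqP.
  rewrite (_ : 2 - _ = 0); last by field.
  by rewrite mul_conjC_eq0 subr_eq0 (negPf lm).
Qed.

Lemma fixer_eigenvalues A w : 0 < herm w w ->
    (forall i j, Zi ((A : 'M_3) i j)) -> fixes_pointwise (projU A) (mirror w) ->
    projU A <> 1%g ->
  exists l m, [/\ l * l^* = 1, (A : 'M_3) = l%:M + (m - l) *: polar_proj w,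
    Zi l & m = - l \/ m = 'i * l \/ m = - 'i * l].
Proof.
move=> w0 hA /(fixer_structure w0)[l [m [hl hm E]]] A1; exists l, m.
have n0 : herm w w != 0 by rewrite gt_eqF.
have lm : l != m.
  apply/eqP => lm; apply: A1; apply/esym/(@pi_eqP _ _ _ l).
  by rewrite E lm subrr scale0r addr0 scalemx1.
have tA : \tr (A : 'M_3) = 2 * l + m.
  by rewrite E mxtraceD mxtraceZ (tr_polar_proj n0) mxtrace_scalar; ring.
have tA2 : \tr ((A : 'M_3) *m A) = 2 * l ^+ 2 + m ^+ 2.
  rewrite E; move: (polar_proj w) (tr_polar_proj n0) (polar_proj_idem n0) => P tP iP.
  rewrite mulmxDl !mulmxDr -!scalemxAl -!scalemxAr iP.
  rewrite mul_scalar_mx mul_mx_scalar mul_scalar_mx.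
  by rewrite !(mxtraceD, mxtraceZ) tP !mxtrace_scalar; ring.
have [] := eigenvalue_arith hl hm _ _ lm => //.
  by rewrite -tA; apply: gauss_sum => i _.
by rewrite -tA2; apply: gauss_sum => i _; apply: gauss_mulmx.
Qed.

End ReflectionArithmetic.

(** * Bezout relations in Z[i] and the norm of a primitive polar vector *)

Section GaussianGcd.
Variable C : numClosedFieldType.
Implicit Types (u v w x : 'cV[C]_3) (A B : UJ C).
Local Notation Zi := (@gaussian_integers C).
Local Notation gz := (gauss_pair C).

Lemma gauss_euclid (y d : C) : Zi y -> Zi d -> d != 0 ->
  exists q, [/\ Zi q & (y - q * d) * (y - q * d)^* < d * d^*].
Proof.
move=> [y1 [y2 ->]] [d1 [d2 ->]]; rewrite -!/(gz _ _) => d0.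
have D0 : 0 < d1 ^+ 2 + d2 ^+ 2.
  by rewrite lt_def -(gz_eq0 C) (negPf d0) addr_ge0 ?sqr_ge0.
have [q1 [q2 H]] := gaussian_division y1 y2 D0.
exists (gz (- q1) (- q2)); split; first exact: gz_gauss.
rewrite gzM gzN gzD !gz_norm ltr_int.
move: H; set X := (_ + _) ^+ 2; set Y := (_ + _) ^+ 2 => H.
rewrite (_ : (y1 + _) ^+ 2 = X); last by rewrite /X; ring.
rewrite (_ : (y2 + _) ^+ 2 = Y); last by rewrite /Y; ring.
have := sqr_ge0 (y1 + (q1 * d1 - q2 * d2)); rewrite -/X => X0.
have := sqr_ge0 (y2 + (q1 * d2 + q2 * d1)); rewrite -/Y => Y0.
by move: X Y X0 Y0 H; lia.
Qed.

(** Descent on the norm of a nonzero combination a w: a coordinate that it does not divide leaves a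
    nonzero Euclidean remainder, which is a combination of smaller norm. *)
Lemma gauss_gcd w : (forall i, Zi (w i 0)) -> w != 0 ->
  exists g (a : 'rV[C]_3), [/\ g != 0, forall i, Zi (a 0 i),
    (a *m w) 0 0 = g & forall i, exists2 q, Zi q & w i 0 = q * g].
Proof.
move=> hw w0.
have [i0 wi0] : exists i, w i 0 != 0.
  apply/not_existsP => H; move/eqP: w0; apply; apply/colP => i; rewrite mxE.
  by apply/eqP/negPn/negP/H.
have [N [a [ha a0 hN]]] : exists (N : nat) (a : 'rV[C]_3), [/\ forall i, Zi (a 0 i),
    (a *m w) 0 0 != 0 & (a *m w) 0 0 * ((a *m w) 0 0)^* < N%:~R].
  have [x1 [x2 E]] := hw i0; rewrite -/(gz _ _) in E.
  exists (absz (x1 ^+ 2 + x2 ^+ 2)).+1, (delta_mx 0 i0).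
  rewrite -rowE mxE; split=> //.
    move=> i; rewrite mxE; exact: gauss_nat.
  by rewrite E gz_norm ltr_int; lia.
elim: N a ha a0 hN => [|N IH] a ha a0 hN.
  by have := le_lt_trans (mul_conjC_ge0 _) hN; rewrite ltxx.
set g := (a *m w) 0 0 in a0 hN.
have [H|/existsNP[i Hi]] := pselect (forall i, exists2 q, Zi q & w i 0 = q * g).
  by exists g, a.
have Zaw (b : 'rV[C]_3) : (forall i, Zi (b 0 i)) -> Zi ((b *m w) 0 0).
  by move=> hb; apply: gauss_mulmx => j k; [rewrite (ord1 j) | rewrite (ord1 k)].
have [q [hq hlt]] := gauss_euclid (hw i) (Zaw _ ha) a0.
pose b := delta_mx 0 i - q *: a.
have Eb : (b *m w) 0 0 = w i 0 - q * g.
  by rewrite /b mulmxBl -rowE -scalemxAl 4!mxE.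
have hb j : Zi (b 0 j).
  rewrite !mxE; apply: gaussD; first exact: gauss_nat.
  by apply/gaussN/gaussM.
apply: (IH b) => //; rewrite Eb.
  by apply/eqP => /eqP; rewrite subr_eq0 => /eqP h; apply: Hi; exists q.
have [r1 [r2 Er]] := Zaw _ hb; have [g1 [g2 Eg]] := Zaw _ ha.
rewrite -!/(gz _ _) -/g Eb in Er Eg; move: hlt hN; rewrite -/g Er Eg !gz_norm !ltr_int.
by move: (_ + _) (_ + _) => /= X Y; lia.
Qed.

Lemma gauss_real_int (x : C) : Zi x -> x^* = x -> exists n : int, x = n%:~R.
Proof.
move=> [a [b ->]]; rewrite -/(gz _ _) gz_conj => /gz_inj[_ h].
exists a; have -> : b = 0 by lia.
by rewrite gz_int.
Qed.

Lemma gauss_herm v w : (forall i, Zi (v i 0)) -> (forall i, Zi (w i 0)) ->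
  Zi (herm v w).
Proof.
move=> hv hw; rewrite hermE.
by do ![apply: gaussD | apply: gaussM | apply: gauss_conj].
Qed.

(** A nonzero column of 2 P is a Gaussian multiple of w; dividing it by its gcd gives w' with a
    Bezout row a such that a w' = 1. Then 2 P J = (2 / <w',w'>) w' w'^*, so a (2 P J) a^* = 2 /
    <w',w'> is Gaussian and the positive integer <w',w'> divides 2. *)
Lemma reflection_polar_norm w : 0 < herm w w ->
    (forall i j, Zi ((2 *: polar_proj w) i j)) ->
  exists c w', [/\ c != 0, w = c *: w', forall i, Zi (w' i 0) &
                   herm w' w' = 1 \/ herm w' w' = 2].
Proof.
move=> w0 h2P; have n0 : herm w w != 0 by rewrite gt_eqF.
have [j Pj] : exists j, col j (2 *: polar_proj w) != 0.
  apply/not_existsP => H; have := tr_polar_proj n0.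
  suff -> : polar_proj w = 0 by rewrite mxtrace0 => /esym/eqP; rewrite oner_eq0.
  have P2 : 2 *: polar_proj w = 0.
    apply/matrixP => i j; have /negP/negPn/eqP/colP/(_ i) := H j.
    by rewrite !mxE.
  by move/eqP: P2; rewrite scaler_eq0 pnatr_eq0 /= => /eqP.
have [g [a [g0 ha Eg Hdiv]]] : exists g (a : 'rV[C]_3), [/\ g != 0, forall i, Zi (a 0 i),
    (a *m col j (2 *: polar_proj w)) 0 0 = g &
    forall i, exists2 q, Zi q & col j (2 *: polar_proj w) i 0 = q * g].
  by apply: gauss_gcd => // i; rewrite mxE.
set u := col j _ in Pj Eg Hdiv.
have [e Ee] : exists e, u = e *: w.
  exists (2 * (herm (delta_mx j 0) w / herm w w)).
  by rewrite /u colE -scalemxAl polar_projE scalerA.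
have e0 : e != 0 by apply/eqP => e0; rewrite Ee e0 scale0r eqxx in Pj.
pose w' := g^-1 *: u.
have Ew : w = (e^-1 * g) *: w'.
  by rewrite /w' scalerA -mulrA divff // mulr1 Ee scalerA mulVf // scale1r.
have c0 : e^-1 * g != 0 by rewrite mulf_neq0 ?invr_eq0.
have gw' i : Zi (w' i 0).
  have [q hq E] := Hdiv i.
  by rewrite mxE E mulrCA mulVf // mulr1.
exists (e^-1 * g), w'; split => //.
have aw' : a *m w' = 1%:M.
  by rewrite /w' -scalemxAr [a *m u]mx11_scalar Eg scale_scalar_mx mulVf.
have n'0 : 0 < herm w' w'.
  move: w0; rewrite {1 2}Ew hermZl hermZr mulrA => w0'.
  rewrite -(pmulr_rgt0 _ (_ : 0 < (e^-1 * g) * (e^-1 * g)^*)) //.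
  by rewrite mul_conjC_gt0.
have n'0' : herm w' w' != 0 by rewrite gt_eqF.
have [p [q Epq]] : Zi (2 / herm w' w').
  suff -> : 2 / herm w' w' = (a *m (2 *: polar_proj w *m Jmx C) *m a ^t*) 0 0.
    apply: gauss_mulmx => [i k|i k]; last by rewrite ord1 !mxE; apply: gauss_conj.
    apply: gauss_mulmx => [i' k'|]; first by rewrite ord1.
    by apply: gauss_mulmx => //; apply: gauss_Jmx.
  have -> : 2 *: polar_proj w *m Jmx C = (2 / herm w' w') *: (w' *m w' ^t*).
    rewrite Ew polar_projZ // /polar_proj scalerA -scalemxAl -!mulmxA.
    by rewrite Jmx_invol mulmx1.
  rewrite -scalemxAr -scalemxAl mxE mulmxA aw' mul1mx.
  by rewrite -map_mxM -trmx_mul aw' trmx1 map_mx1 mxE mulr1.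
have [n En] : exists n : int, herm w' w' = n%:~R.
  by apply: gauss_real_int; [apply: gauss_herm | rewrite -hermC].
rewrite -/(gz p q) in Epq.
have : gz (n * p) (n * q) = gz 2 0.
  transitivity (herm w' w' * gz p q).
    by rewrite En (gz_int C) gzM; congr gauss_pair; ring.
  by rewrite -Epq mulrC divfK // -gz_int.
move=> /gz_inj[np _]; move: n'0; rewrite En ltr0z => n0'.
have p0 : 0 < p by rewrite -(pmulr_rgt0 _ n0') np.
have : n <= n * p by rewrite ler_peMr // ltW.
rewrite np => n2; have : n = 1 \/ n = 2 by lia.
by case=> ->; [left|right].
Qed.

Lemma reflection_reaches A w : 0 < herm w w ->
    (forall i j, Zi ((A : 'M_3) i j)) -> fixes_pointwise (projU A) (mirror w) ->
    projU A <> 1%g ->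
  reaches_model w.
Proof.
move=> w0 hA hF A1; have [l [m [hl E Zl hm]]] := fixer_eigenvalues w0 hA hF A1.
have Zml i j : Zi (((m - l) *: polar_proj w) i j).
  have -> : (m - l) *: polar_proj w = (A : 'M_3) - l%:M by rewrite E addrAC subrr add0r.
  rewrite mxE; apply: gaussD => //; rewrite !mxE; apply: gaussN.
  by case: (i == j) => //; exact: gauss0.
(* Up to the unit l, the difference m - l is -2, i - 1 or -i - 1, each a divisor of 2; the inverse
   of l is conj(l). *)
have [e Ze Ee] : exists2 e, Zi e & 2 = e * (m - l).
  have Zlc := gauss_conj Zl; have Zi' := gaussi C.
  case: hm => [->|[->|->]].
  - by exists (- l^*); [apply: gaussN | ring: hl].
  - exists ((- 'i - 1) * l^*); last by ring: hl (sqrCi C).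
    by apply: gaussM => //; apply: gaussD; apply: gaussN => //; apply: gauss1.
  exists (('i - 1) * l^*); last by ring: hl (sqrCi C).
  by apply: gaussM => //; apply: gaussD => //; apply: gaussN => //; apply: gauss1.
have [|c [w' [c0 -> gw' hn]]] := reflection_polar_norm w0.
  by move=> i j; rewrite Ee -scalerA mxE; apply: gaussM.
apply: (@reaches_scale _ c^-1); first by rewrite invr_eq0.
rewrite scalerA mulVf // scale1r.
have [[x1 [x2 Ex]] [[y1 [y2 Ey]] [z1 [z2 Ez]]]] := (gw' 0, (gw' 1, gw' 2%R)).
have [n nE En] : exists2 n : int, (n == 1) || (n == 2) & herm w' w' = n%:~R.
  by case: hn => ->; [exists 1|exists 2].
rewrite (col3P w') Ex Ey Ez -!/(gz _ _); apply: reaches_of_norm nE _.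
apply: (@intr_inj C); rewrite -En hermE Ex Ey Ez -!/(gz _ _) !gz_conj /gauss_pair.
by ring: (sqrCi C).
Qed.

End GaussianGcd.

Lemma cyclic_of_order_powers (G : groupType) (g : G) (n : nat) (H : set G) :
    (0 < n)%N -> (g ^+ n = 1)%g ->
    (forall i j, (i < n)%N -> (j < n)%N -> (g ^+ i = g ^+ j)%g -> i = j) ->
    H = [set (g ^+ i)%g | i in `I_n] ->
  cyclic_of_order H n.
Proof.
move=> n0 gn inj ->; split; last first.
  by apply: inj_card_eq => i j; rewrite !inE /=; apply: inj.
have gmod k : (g ^+ (k %% n) = g ^+ k)%g.
  by rewrite {2}(divn_eq k n) expgnDr mulnC expgnA gn expg1n mul1g.
exists g; apply/seteqP; split => x /=.
  by case=> i _ <-; left; exists i.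
case=> -[k _ <-].
  by exists (k %% n)%N => //=; rewrite ltn_mod.
(* The outer reduction matters when n divides k, where n - k %% n would be n itself. *)
exists ((n - k %% n) %% n)%N; first by rewrite /= ltn_mod.
rewrite gmod -(gmod k); apply: (mulIg (g ^+ (k %% n))%g).
by rewrite -expgnDr subnK ?gn ?mulVg // ltnW // ltn_mod.
Qed.

(** * Mirrors, inequivalence of the models, and reflections with a given mirror *)

Section Mirrors.
Variable C : numClosedFieldType.
Implicit Types (u v w x : 'cV[C]_3) (A B : UJ C).
Local Notation Zi := (@gaussian_integers C).
Local Notation gz := (gauss_pair C).

Lemma projU_eqP A B : projU A = projU B ->
  exists c, (B : 'M_3) = c *: (A : 'M_3).
Proof. by move/(eqmodP (scalar_eq_equiv C))/scalar_eqP. Qed.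

Lemma mirrorZ c w : c != 0 -> mirror (c *: w) = mirror w.
Proof.
move=> c0; apply/seteqP; split => L [v /= [v0 vw] <-]; exists v => //=; split => //.
  by move: vw; rewrite hermZr => /eqP; rewrite mulf_eq0 conjC_eq0 (negPf c0) => /eqP.
by rewrite hermZr vw mulr0.
Qed.

Lemma mirror_act A w : act (projU A) @` mirror w = mirror ((A : 'M_3) *m w).
Proof.
apply/seteqP; split => L /=.
  case=> _ [v [v0 vw] <-] <-; rewrite act_pi_line.
  by exists ((A : 'M_3) *m v) => //=; rewrite !herm_UJ.
case=> v [v0 vw] <-; pose u := invmx A *m v.
have Eu : (A : 'M_3) *m u = v by rewrite mulKVmx ?UJ_unit.
exists <[u]>%VS; last by rewrite act_pi_line Eu.
by exists u => //=; rewrite -(herm_UJ A u u) -(herm_UJ A u w) Eu.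
Qed.

Lemma reaches_orbit w : reaches_model w ->
  exists k, Gamma1_orbit (mirror (mirror_vector C k)) (mirror w).
Proof.
move=> [A [k [c [hA c0 ->]]]]; exists k; exists (projU A); first by exists A.
by rewrite mirror_act mirrorZ.
Qed.

(** A negative v projects to a point of the first mirror, hence of the second, so v is orthogonal to
    the projection of w' to the polar plane of w. Negative vectors span C^3, so that projection
    vanishes. *)
Lemma mirror_sub w w' : 0 < herm w w -> mirror w `<=` mirror w' ->
  w' = (herm w' w / herm w w) *: w.
Proof.
move=> w0 S; have Hneg v : herm v v < 0 -> herm v (toward_mirror w w') = 0.
  move=> v0; rewrite -toward_mirror_adj //.
  have /S[u [u0 uw'] E] : mirror w <[toward_mirror w v]>%VS.
    exists (toward_mirror w v) => //; split; last exact: herm_toward_mirror.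
    exact: toward_mirror_lt0.
  have := memv_line (toward_mirror w v); rewrite -E => /vlineP[k ->].
  by rewrite hermZl uw' mulr0.
apply/eqP; rewrite -subr_eq0; apply/eqP; apply: herm_nondeg => v.
rewrite (negative_span v) !(hermDl, hermZl).
by rewrite !Hneg ?herm_real_col3 ?ltrz0 // !mulr0 !addr0.
Qed.

Lemma gauss_unit_norm (c : C) : Zi c -> Zi c^-1 -> c != 0 -> c * c^* = 1.
Proof.
move=> [a [b Ec]] [a' [b' Ed]] c0; rewrite -!/(gz _ _) in Ec Ed.
rewrite Ec gz_norm; have : (a ^+ 2 + b ^+ 2) * (a' ^+ 2 + b' ^+ 2) = 1.
  apply: (@intr_inj C); rewrite rmorphM /= -!gz_norm -Ec -Ed fmorphV /=.
  have cc0 : c^* != 0 by rewrite conjC_eq0.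
  by field; rewrite c0 cc0.
have := sqr_ge0 a; have := sqr_ge0 b; have := sqr_ge0 a'; have := sqr_ge0 b'.
move=> b'0 a'0 b0 a0 E.
have : (0 <= a ^+ 2 + b ^+ 2) by lia.
have : (0 <= a' ^+ 2 + b' ^+ 2) by lia.
move: E; move: (_ + b ^+ 2) (_ + b' ^+ 2) => X Y E Y0 X0.
have Xp : 0 < X by rewrite lt_def X0 andbT; apply/eqP => h; rewrite h mul0r in E.
have Yp : 0 < Y by rewrite -(pmulr_rgt0 _ Xp) E.
have : X <= X * Y by rewrite ler_peMr // ltW.
by rewrite E => X1; have -> : X = 1 by lia.
Qed.

Lemma mirror_vector_gauss k i : Zi (mirror_vector C k i 0).
Proof.
move: k i; apply: ord3P; apply: ord3P; rewrite !mxE /=;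
  by [exact: gauss0 | exact: gauss1 | exact/gaussN/gauss1].
Qed.

Lemma mirror_vector_herm k :
  herm (mirror_vector C k) (mirror_vector C k) = [:: 1; 1; 2]`_k.
Proof.
by move: k; apply: ord3P; rewrite hermE !mxE /= ?rmorphN ?rmorph0 ?rmorph1; ring.
Qed.

Lemma mirror_vector_gt0 k : 0 < herm (mirror_vector C k) (mirror_vector C k).
Proof. by rewrite mirror_vector_herm; move: k; apply: ord3P. Qed.

(** Each model has a coordinate equal to 1. *)
Lemma mirror_vector_coord k c : (forall i, Zi ((c *: mirror_vector C k) i 0)) -> Zi c.
Proof.
move: k; apply: ord3P => H; [move: (H 1)|move: (H 0)|move: (H 0)];
  by rewrite !mxE mulr1.
Qed.

Lemma gauss_mulcol A k i : (forall i j, Zi ((A : 'M_3) i j)) ->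
  Zi (((A : 'M_3) *m mirror_vector C k) i 0).
Proof.
by move=> hA; apply: gauss_mulmx => // j l; rewrite ord1; apply: mirror_vector_gauss.
Qed.

(* For isotropic v the middle coordinate has even norm, so the functional
   herm v w_1 takes no unit value on isotropic Gaussian vectors, whereas
   herm v w_2 = 1 at v = (0,0,1). *)
Lemma mirror_vector01 A (c : C) : (forall i j, Zi ((A : 'M_3) i j)) ->
  c * c^* = 1 -> (A : 'M_3) *m mirror_vector C 0 <> c *: mirror_vector C 1.
Proof.
move=> hA hc E; pose u := col3 0 0 1 : 'cV[C]_3; pose v := invmx A *m u.
have Ev : (A : 'M_3) *m v = u by rewrite mulKVmx ?UJ_unit.
have gv i : Zi (v i 0).
  have [_ _ hV] := gauss_GL3 hA.
  apply: gauss_mulmx => // j k; rewrite ord1 mxE /=.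
  by move: j; apply: ord3P; [exact: gauss0 | exact: gauss0 | exact: gauss1].
have v1 : v 1 0 = c^*.
  have := herm_UJ A v (mirror_vector C 0); rewrite Ev E.
  rewrite herm_col3 hermE !mxE /= !(rmorph0, rmorph1, mul0r, mulr0, mulr1, mul1r, add0r, addr0).
  by [].
have vv : herm v v = 0.
  by rewrite -(herm_UJ A) Ev herm_col3 !mxE /= !(rmorph0, mul0r, mulr0, addr0).
have [[x1 [x2 Ex]] [z1 [z2 Ez]]] := (gv 0, gv 2%R); rewrite -!/(gz _ _) in Ex Ez.
have : 2 * (x1 * z1 + x2 * z2) + 1 = 0.
  apply: (@intr_inj C); rewrite mulr0z -vv hermE v1 Ex Ez !gz_conj conjCK.
  by rewrite /gauss_pair; ring: hc (sqrCi C).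
lia.
Qed.

(** Applying A and its inverse to models shows that c and c^-1 are both Gaussian, so |c| = 1 and the
    two models have equal norms; [mirror_vector01], for A or its inverse, handles the two models of
    norm 1. *)
Lemma mirror_vector_inj A (c : C) k k' : (forall i j, Zi ((A : 'M_3) i j)) -> c != 0 ->
  (A : 'M_3) *m mirror_vector C k = c *: mirror_vector C k' -> k = k'.
Proof.
move=> hA c0 E; have [_ _ hV] := gauss_GL3 hA.
have EV : ((A^-1)%g : UJ C) *m mirror_vector C k' = c^-1 *: mirror_vector C k :> 'cV_3.
  rewrite -[mirror_vector C k' in LHS](scalerK c0) -E -scalemxAr.
  by rewrite mulKmx ?UJ_unit.
have hc : c * c^* = 1.
  apply: gauss_unit_norm => //.
    by apply: (@mirror_vector_coord k') => i; rewrite -E; apply: gauss_mulcol.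
  by apply: (@mirror_vector_coord k) => i; rewrite -EV; apply: gauss_mulcol.
have hcV : c^-1 * (c^-1)^* = 1 by rewrite fmorphV /= -invfM hc invr1.
have := herm_UJ A (mirror_vector C k) (mirror_vector C k).
rewrite E hermZl hermZr mulrA hc mul1r !mirror_vector_herm.
have N12 : (1 : C) <> 2.
  by move/eqP; rewrite -[1]/(1%:R) eqr_nat.
move: k k' E EV; apply: ord3P; apply: ord3P => E EV //= h.
- by case: (mirror_vector01 hA hc E).
- by case: N12.
- by case: (@mirror_vector01 (A^-1)%g _ hV hcV EV).
- by case: N12.
Qed.

Lemma orbit_mirror_vector_inj k k' M :
  Gamma1_orbit (mirror (mirror_vector C k)) M ->
  Gamma1_orbit (mirror (mirror_vector C k')) M -> k = k'.
Proof.
move=> [_ [A /= hA <-] <-] [_ [B /= hB <-]]; rewrite !mirror_act => E.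
have hBV := GL3_gaussV hB.
have pos : 0 < herm ((B : 'M_3) *m mirror_vector C k') ((B : 'M_3) *m mirror_vector C k').
  by rewrite herm_UJ mirror_vector_gt0.
have S : mirror ((B : 'M_3) *m mirror_vector C k') `<=` mirror ((A : 'M_3) *m mirror_vector C k).
  by rewrite E.
have := mirror_sub pos S; set c := _ / _ => Ec.
apply: (@mirror_vector_inj (B^-1 * A)%g c).
- exact/GL3_gauss/GL3_gaussM.
- apply/eqP => c0; move: Ec; rewrite c0 scale0r => h.
  by have := mirror_vector_gt0 k; rewrite -(herm_UJ A) h herm0l ltxx.
by rewrite /= -mulmxA Ec -scalemxAr mulKmx ?UJ_unit.
Qed.

(** The identity on the polar plane and multiplication by z on w, when <w,w> is nonzero. *)
Definition refl_mx w (z : C) : 'M[C]_3 := 1%:M + (z - 1) *: polar_proj w.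

Lemma refl_mxE w z v : refl_mx w z *m v = v + ((z - 1) * (herm v w / herm w w)) *: w.
Proof. by rewrite mulmxDl mul1mx -scalemxAl polar_projE scalerA. Qed.

Lemma refl_mxM w z z' : herm w w != 0 ->
  refl_mx w z *m refl_mx w z' = refl_mx w (z * z').
Proof.
move/polar_proj_idem; rewrite /refl_mx; move: (polar_proj w) => P iP.
rewrite mulmxDl !mulmxDr -!scalemxAl -!scalemxAr iP.
rewrite !mul1mx mulmx1 -addrA; congr (_ + _).
by rewrite scalerA -!scalerDl; congr (_ *: _); ring.
Qed.

Lemma in_UJ_herm (A : 'M[C]_3) :
  (forall u v, herm (A *m u) (A *m v) = herm u v) -> in_UJ A.
Proof.
move=> H; apply: in_UJP; apply/matrixP => i j.
have := H (delta_mx j 0) (delta_mx i 0).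
have K (B : 'M[C]_3) (u v : 'cV[C]_3) :
    (B *m v) ^t* *m Jmx C *m (B *m u) = v ^t* *m (B ^t* *m Jmx C *m B) *m u.
  by rewrite trmx_mul map_mxM !mulmxA.
have D : (delta_mx i 0 : 'cV[C]_3) ^t* = delta_mx 0 i :> 'rV[C]_3.
  by apply/rowP => l; rewrite !mxE eqxx andbT rmorph_nat.
rewrite /herm K D -!rowE -!colE.
by rewrite !mxE.
Qed.

Lemma refl_UJ w z : 0 < herm w w -> z * z^* = 1 -> in_UJ (refl_mx w z).
Proof.
move=> w0 hz; apply: in_UJ_herm => u v; rewrite !refl_mxE.
have n0 : herm w w != 0 by rewrite gt_eqF.
have nR : (herm w w)^* = herm w w by rewrite -hermC.
rewrite !(hermDl, hermDr, hermZl, hermZr) !rmorphM rmorphB fmorphV rmorph1 /= nR -(hermC v w).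
by field: hz.
Qed.

(** [insubd] falls back to the identity when the matrix is not unitary, so the lemmas below assume
    |z| = 1. *)
Definition refl w (z : C) : PUJ C := projU (insubd (1%g : UJ C) (refl_mx w z)).

Section Reflection.
Variables (w : 'cV[C]_3) (w0 : 0 < herm w w).
Let n0 : herm w w != 0. Proof. by rewrite gt_eqF. Qed.

Lemma val_refl z : z * z^* = 1 -> val (insubd (1%g : UJ C) (refl_mx w z)) = refl_mx w z.
Proof. by move=> hz; rewrite insubdK //; apply: refl_UJ. Qed.

Lemma refl1 : refl w 1 = 1%g.
Proof.
congr projU; apply: val_inj; rewrite /= val_refl ?rmorph1 ?mulr1 //.
by rewrite /refl_mx subrr scale0r addr0.
Qed.

Lemma reflM z z' : z * z^* = 1 -> z' * z'^* = 1 ->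
  refl w (z * z') = (refl w z * refl w z')%g.
Proof.
move=> hz hz'; rewrite [RHS]PUJ_mulE; congr projU; apply: val_inj => /=.
rewrite !val_refl ?refl_mxM // rmorphM /=.
by ring: hz hz'.
Qed.

Lemma reflX z k : z * z^* = 1 -> refl w (z ^+ k) = (refl w z ^+ k)%g.
Proof.
move=> hz; have hzk i : z ^+ i * (z ^+ i)^* = 1 by rewrite rmorphXn -exprMn hz expr1n.
by elim: k => [|k IH]; rewrite ?refl1 // exprS reflM // IH expgS.
Qed.

Lemma refl_inj z z' : z * z^* = 1 -> z' * z'^* = 1 -> refl w z = refl w z' -> z = z'.
Proof.
move=> hz hz' /projU_eqP[c]; rewrite !val_refl // => E.
pose p := toward_mirror w (col3 1 0 (-1)).
have pn : herm p p < 0.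
  apply: toward_mirror_lt0 => //.
  have := @herm_real_col3 C 1 0 (-1); rewrite /= mulrN1z => ->.
  by rewrite ltrz0.
(* Both matrices fix the vector p of the polar plane, which removes the projective ambiguity;
   evaluation at w then compares z and z'. *)
have c1 : c = 1.
  have := congr1 (mulmx^~ p) E; rewrite -scalemxAl !refl_mxE herm_toward_mirror //.
  rewrite mul0r !mulr0 !scale0r !addr0 => /eqP.
  rewrite -subr_eq0 -{1}[p]scale1r -scalerBl scaler_eq0 (negPf (herm_lt0_neq0 pn)) orbF.
  by rewrite subr_eq0 => /eqP.
have := congr1 (mulmx^~ w) E; rewrite c1 scale1r !refl_mxE divff // !mulr1.
move/addrI/eqP; rewrite -subr_eq0 -scalerBl scaler_eq0 => /orP[].
  by rewrite opprB addrA subrK subr_eq0 => /eqP.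
by move=> /eqP h; move: w0; rewrite h herm0l ltxx.
Qed.

Lemma refl_fixer z : z * z^* = 1 ->
    (forall i j, Zi (((z - 1) *: polar_proj w) i j)) ->
  Gamma1_fixer (mirror w) (refl w z).
Proof.
move=> hz hP; split.
  exists (insubd (1%g : UJ C) (refl_mx w z)) => //.
  apply: gauss_GL3 => i j; rewrite val_refl // mxE; apply: gaussD => //.
  by rewrite mxE; exact: gauss_nat.
move=> _ [v [v0 vw] <-]; rewrite act_pi_line val_refl // refl_mxE vw mul0r mulr0.
by rewrite scale0r addr0.
Qed.

(** Dividing the lift by l leaves the reflection with multiplier m / l. For odd exponents m - l is
    an associate of i - 1, so integrality of the lift passes to (i - 1) P; this obstructs order 4
    for w_3. *)
Lemma fixer_refl g : Gamma1_fixer (mirror w) g ->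
  exists2 k, (k < 4)%N & g = refl w ('i ^+ k) /\
    (odd k -> forall i j, Zi ((('i - 1) *: polar_proj w) i j)).
Proof.
move=> [[A hA <-] hF]; have [->|A1] := pselect (projU A = 1%g).
  by exists 0%N => //; rewrite expr0 refl1.
have gA := GL3_gauss hA.
have [l [m [hl E Zl hm]]] := fixer_eigenvalues w0 gA hF A1.
have Zlc := gauss_conj Zl.
have hml i j : Zi (((m - l) *: polar_proj w) i j).
  have -> : (m - l) *: polar_proj w = (A : 'M_3) - l%:M by rewrite E addrAC subrr add0r.
  rewrite mxE; apply: gaussD => //; rewrite !mxE; apply: gaussN.
  by case: (i == j) => //; exact: gauss0.
have hi : 'i * 'i^* = 1 :> C by rewrite conjCi mulrN -expr2 sqrCi opprK.
have key k : m = 'i ^+ k * l -> projU A = refl w ('i ^+ k).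
  move=> Em; have hk : 'i ^+ k * ('i ^+ k)^* = 1 :> C.
    by rewrite rmorphXn -exprMn hi expr1n.
  apply/esym/(@pi_eqP _ _ _ l); rewrite val_refl // E Em /refl_mx scalerDr scalemx1.
  by rewrite scalerA; congr (_ + _ *: _); ring.
have odd_key e : Zi e -> 'i - 1 = e * (m - l) ->
    forall i j, Zi ((('i - 1) *: polar_proj w) i j).
  by move=> Ze Ee i j; rewrite Ee -scalerA mxE; apply: gaussM.
case: hm => [Em|[Em|Em]].
- exists 2%N => //; split=> //; apply: key; rewrite Em sqrCi; ring.
- exists 1%N => //; split; first by apply: key.
  by move=> _; apply: (@odd_key l^*) => //; rewrite Em; ring: hl.
exists 3%N => //; split; first by apply: key; rewrite Em exprS sqrCi; ring.
move=> _; apply: (@odd_key (- 'i * l^*)); last by rewrite Em; ring: hl (sqrCi C).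
by apply: gaussM => //; apply/gaussN/gaussi.
Qed.

Lemma fixer_cyclic z n : (0 < n)%N -> Zi z -> z * z^* = 1 -> n.-primitive_root z ->
    (forall i j, Zi (((z - 1) *: polar_proj w) i j)) ->
    (forall g, Gamma1_fixer (mirror w) g -> exists k, g = refl w (z ^+ k)) ->
  cyclic_of_order (Gamma1_fixer (mirror w)) n.
Proof.
move=> n0' Zz hz pz hP H; have zn := prim_expr_order pz.
have hzk i : z ^+ i * (z ^+ i)^* = 1 by rewrite rmorphXn -exprMn hz expr1n.
apply: (@cyclic_of_order_powers _ (refl w z)) => //.
- by rewrite -reflX // zn refl1.
- move=> i j hi hj; rewrite -!reflX // => /refl_inj E.
  have /eqP := E (hzk i) (hzk j).
  by rewrite (eq_prim_root_expr pz) !modn_small // => /eqP.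
apply/seteqP; split => [g /H[k ->]|_ [k _ <-]] /=.
  exists (k %% n)%N; first by rewrite /= ltn_mod.
  by rewrite -reflX // (prim_expr_mod pz).
rewrite -reflX //; apply: refl_fixer => // i j.
(* [z - 1] divides [z ^+ k - 1] with a Gaussian quotient, so integrality for the generator passes to
   its powers. *)
rewrite subrX1 mulrC -scalerA mxE; apply: gaussM => //.
by apply: gauss_sum => a _; apply: gaussX.
Qed.

End Reflection.

End Mirrors.

(** * Uniqueness of the orbit and the orders 4, 4, 2 *)

Section MainTheorem.
Variable C : numClosedFieldType.
Local Notation Zi := (@gaussian_integers C).

Lemma i_primitive_root : 4.-primitive_root ('i : C).
Proof.
have i3 : 'i ^+ 3 = - 'i :> C by rewrite exprS sqrCi mulrN1.
apply/andP; split=> //; apply/forallP => -[[|[|[|[|//]]]] lt4] /=;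
  rewrite unity_rootE ?expr1 ?sqrCi ?i3 ?(exprM _ 2 2) ?sqrCi ?sqrrN ?expr1n ?eqxx //;
  apply/eqP/negbTE/eqP; rewrite ?(gz_i C) -(gz1 C) ?gzN => /gz_inj[]; lia.
Qed.

Lemma opp1_primitive_root : 2.-primitive_root (-1 : C).
Proof.
apply/andP; split=> //; apply/forallP => -[[|[|//]] lt2] /=;
  rewrite unity_rootE ?expr1 ?sqrrN ?expr1n ?eqxx //.
apply/eqP/negbTE/eqP; rewrite -(gz1 C) gzN => /gz_inj[]; lia.
Qed.

Lemma gauss_polar_proj (w : 'cV[C]_3) i j : herm w w != 0 ->
  (forall i, Zi (w i 0)) -> Zi ((herm w w *: polar_proj w) i j).
Proof.
move=> w0 hw; rewrite scalerA divff // scale1r; apply: gauss_mulmx => k l.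
  by rewrite ord1.
apply: gauss_mulmx => m n; last exact: gauss_Jmx.
by apply: gauss_trC => a b; rewrite ord1.
Qed.

Theorem Gamma1_reflection_orbit (g : PUJ C) (M : set {vspace 'cV[C]_3}) :
  Gamma1 g -> complex_reflection g M ->
  exists! k : 'I_3, Gamma1_orbit (mirror (mirror_vector C k)) M.
Proof.
move=> [A hA <-] [A1 _ [w w0 ->] hF].
have [k hk] := reaches_orbit (reflection_reaches w0 (GL3_gauss hA) hF A1).
by exists k; split=> // k'; apply: orbit_mirror_vector_inj.
Qed.

(** The top left entry of P for w_3 is 1/2, and (i - 1) / 2 is not a Gaussian integer. *)
Lemma mirror_vector2_no_order4 :
  ~ (forall i j, Zi ((('i - 1) *: polar_proj (mirror_vector C 2%R)) i j)).
Proof.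
move/(_ 0 0); rewrite /polar_proj mirror_vector_herm !mxE.
rewrite big_ord1 !mxE sum3 !mxE /=.
rewrite !(rmorph0, rmorph1, mul0r, mulr0, mulr1, mul1r, add0r) => -[a [b E]].
have : gauss_pair C (-1) 1 = gauss_pair C (2 * a) (2 * b); last by move=> /gz_inj[]; lia.
transitivity (2 * (('i - 1) / 2) : C); first by rewrite /gauss_pair; field.
by rewrite E /gauss_pair; ring.
Qed.

Theorem Gamma1_fixer_cyclic (k : 'I_3) :
  cyclic_of_order (Gamma1_fixer (mirror (mirror_vector C k)))
    (nth 0%N [:: 4%N; 4%N; 2%N] k).
Proof.
have ii : 'i * 'i^* = 1 :> C by rewrite conjCi mulrN -expr2 sqrCi opprK.
have w0 := mirror_vector_gt0 C k.
have hP := gauss_polar_proj _ _ (lt0r_neq0 w0) (mirror_vector_gauss C k).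
rewrite mirror_vector_herm in hP.
have Zi' : Zi ('i - 1) by apply: gaussD; [apply: gaussi | apply/gaussN/gauss1].
have order4 : [:: 1; 1; 2]`_k = 1 :> C ->
    cyclic_of_order (Gamma1_fixer (mirror (mirror_vector C k))) 4.
  move=> h; apply: (fixer_cyclic w0 _ (gaussi C) ii i_primitive_root) => //.
    by move=> i j; rewrite mxE; apply: gaussM => //; have := hP i j; rewrite h scale1r.
  by move=> g /(fixer_refl w0)[l _ [-> _]]; exists l.
move: k w0 hP order4; apply: ord3P => w0 hP order4 /=; do ?exact: order4.
have oo : -1 * (-1)^* = 1 :> C by rewrite rmorphN rmorph1 mulrNN mulr1.
(* For w_3 the generator has multiplier -1: its integrality is that of -2 P, and the surviving even
   powers of i are the powers of -1. *)
apply: (fixer_cyclic w0 _ (gaussN (gauss1 C)) oo opp1_primitive_root) => //.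
  move=> i j; rewrite -opprD -[1 + 1]/(2 : C) scaleNr mxE; apply: gaussN; exact: hP.
move=> g /(fixer_refl w0)[l l4 [-> hl]].
have {hl} lE : ~~ odd l by apply/negP => /hl; exact: mirror_vector2_no_order4.
exists l./2; rewrite -[in LHS](odd_double_half l) (negPf lE) add0n -mul2n exprM.
by rewrite sqrCi.
Qed.

End MainTheorem.

Local Open Scope complex_scope.

Theorem mainTheorem5 (R : realType) :
  (forall (g : PUJ R[i]) (M : set {vspace 'cV[R[i]]_3}),
     Gamma1 g -> complex_reflection g M ->
     exists! k : 'I_3, Gamma1_orbit (mirror (mirror_vector R[i] k)) M) /\
  (forall k : 'I_3,
     cyclic_of_order (Gamma1_fixer (mirror (mirror_vector R[i] k)))
       (nth 0%N [:: 4%N; 4%N; 2%N] k)).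
Proof.
by split; [exact: Gamma1_reflection_orbit | exact: Gamma1_fixer_cyclic].
Qed.
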